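(* Let $\alpha \ge 1$. Let $(\delta_m)_{m<\omega}$ be a sequence in $(0,1)$ with $0<\inf_m\delta_m\le\sup_m\delta_m<1$, and let $(k_m)_{m<\omega}$ be an increasing sequence in $\omega\setminus\{0,1\}$ with $k_{m+1}\ge 2k_m$ for all $m$. Let $a_0=0$ and $a_l=a_{l-1}+1+(l-1)a_{l-1}$ for $l>0$, and let $I_l=[a_l,a_{l+1})\cap\omega$. For $U\in P(\omega)$ define $u_U(0)=1$ and, for $n>0$, $u_U(n)=\delta_m u_U(n-1)$ if $n=k_m$ for some $m\in I_l$ with $l\in U$, and $u_U(n)=u_U(n-1)$ otherwise. Let $\varphi:[0,1]\to\mathbb{R}^+$ be continuous and essentially increasing with $\varphi(x)>0$ for $x>0$, and suppose there is $\lambda>0$ with $\varphi(x^2)\ge\lambda\varphi(x)$ for all $x\in[0,1]$. For every $U\in P(\omega)$ let $\varphi_U:[0,1]\to\mathbb{R}^+$ be a continuous increasing function with $\varphi_U(1/2^n)=u_U(n)$ for each $n<\omega$, and set $f_U(x)=x^\alpha\varphi(x)\varphi_U(x)$ for $x\in[0,1]$. Then each $\mathbf{E}_{f_U}$ is an equivalence relation, and for all $U,V\in P(\omega)$, \[ U\subseteq^{*}V\Longleftrightarrow \mathbf{E}_{f_U}\le_B\mathbf{E}_{f_V}. \]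
   Context: $\mathbb{R}^+$ denotes the set of nonnegative reals. A function $f:\mathbb{D}\to\mathbb{R}$ ($\mathbb{D}\subseteq\mathbb{R}$) is essentially increasing on $\mathbb{D}$ if there is $C\ge1$ with $f(x)\le Cf(y)$ whenever $x,y\in\mathbb{D}$, $x\le y$. For $f:[0,1]\to\mathbb{R}^+$, $\mathbf{E}_f$ is the relation on $[0,1]^\omega$ defined by $(x_n)\,\mathbf{E}_f\,(y_n)\iff\sum_{n<\omega}f(|y_n-x_n|)<\infty$. $E\le_B F$ means there is a Borel map $\theta$ with $xEy\iff\theta(x)F\theta(y)$. $U\subseteq^*V$ means $U\setminus V$ is finite. *)

(* Defs.v *)
From HB Require Import structures.
From Stdlib Require Export Relation_Definitions.
From mathcomp Require Export all_boot all_order all_algebra.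
From mathcomp Require Export all_classical all_reals all_analysis.
Set Implicit Arguments.
Unset Strict Implicit.
Unset Printing Implicit Defensive.
Import Order.TTheory GRing.Theory Num.Theory.
Import numFieldNormedType.Exports.
Local Open Scope classical_set_scope.
Local Open Scope ring_scope.

(* [0,1]^omega: the subspace topology on [0,1] and the product topology on
   sequences, so that its Borel sets are those of the Hilbert cube. *)
Definition unit_cube (R : realType) : topologicalType :=
  {ptws nat -> set_type `[0 : R, 1]}.

Definition Borel_map (X Y : topologicalType) (theta : X -> Y) : Prop :=
  forall B : set Y, <<s @open Y >> B -> <<s @open X >> (theta @^-1` B).

Definition Borel_reducible (X Y : topologicalType)
    (E : relation X) (F : relation Y) : Prop :=
  exists2 theta : X -> Y, Borel_map theta &
    forall x y : X, E x y <-> F (theta x) (theta y).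

(* Functions on [0,1] are represented by functions on R of which only the
   values on [0,1] matter; |y_n - x_n| always lies in [0,1] below. *)
Definition E_rel (R : realType) (f : R -> R) : relation (unit_cube R) :=
  fun x y =>
    (\sum_(0 <= n <oo) (f `|set_val (y n) - set_val (x n)|)%:E < +oo)%E.

Definition essentially_increasing (R : realType) (D : set R) (f : R -> R) :
    Prop :=
  exists2 C : R, 1 <= C &
    forall x y, D x -> D y -> x <= y -> f x <= C * f y.

Definition almost_subset (U V : set nat) : Prop := finite_set (U `\` V).

Fixpoint a_ (l : nat) : nat :=
  if l is l'.+1 then (a_ l' + 1 + l' * a_ l')%N else 0%N.

Definition I_ (l : nat) : set nat := [set m | (a_ l <= m < a_ l.+1)%N].

(* When k is injective the index m chosen by cid is the only one. *)
Fixpoint u_ (R : realType) (delta : nat -> R) (k : nat -> nat)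
    (U : set nat) (n : nat) : R :=
  if n is n'.+1 then
    match pselect (exists m, n = k m /\ exists2 l, U l & I_ l m) with
    | left h => delta (projT1 (cid h)) * u_ delta k U n'
    | right _ => u_ delta k U n'
    end
  else 1.

Definition f_ (R : realType) (alpha : R) (phi phiU : R -> R) : R -> R :=
  fun x => x `^ alpha * phi x * phiU x.

(* Main.v *)
Require Import Defs.
From HB Require Import structures.
From Stdlib Require Import Relation_Definitions.
From mathcomp Require Import all_boot all_order all_algebra.
From mathcomp Require Import all_classical all_reals all_analysis.
From mathcomp Require Import ring lra zify.
Set Implicit Arguments.
Unset Strict Implicit.
Unset Printing Implicit Defensive.
Import Order.TTheory GRing.Theory Num.Theory.
Import numFieldNormedType.Exports.
Local Open Scope classical_set_scope.
Local Open Scope ring_scope.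

(* Write [f = f_U] and [g = f_V].  Everything about [f] and [g] is read off from
   four properties (the record [gauge]): [g 0 = 0], [g > 0] on ]0, 1], [g x / x]
   is essentially increasing, and [g x * g y <= C * g (x * y)].  The last one
   comes from [phi (x ^ 2) >= lambda * phi x], which [phi_U] satisfies as well
   because the [k m] at least double.  On the grid [2 ^- n] one has
   [f / g = u_U / u_V].

   If [U `\` V] is finite then [u_U / u_V] is eventually nondecreasing.  Choose
   integers [M n] of the order of [f (2 ^- n) / g (2 ^- n)] and send a point of
   [0, 1] to [M n - M (n - 1)] copies, for each [n], of zigzag functions of slope
   1 and amplitude [2 ^- n]: two points at distance [d] of the order of [2 ^- n]
   then receive a total [g]-distance of the order of [M n * g d], that is, [f d].

   If [U `\` V] is infinite then [u_U / u_V], hence [f / g], is arbitrarily small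
   at some [2 ^- n].  Suppose that a Borel reduction exists.  Rounding its
   coordinates makes it locally constant on a comeager set of sequences of dyadic
   points, and a fusion argument turns it into a map that sends the grid of mesh
   [1 / N_j] at coordinate [j] to its own finite block of coordinates.  The two
   ends of a grid have images at [g]-distance bounded below, so by a Jensen type
   inequality some step of length [1 / N_j] is sent to a pair at [g]-distance at
   least of the order of [g (1 / N_j)].  Repeating the meshes so that the sum of
   the [f (1 / N_j)] converges and the sum of the [g (1 / N_j)] diverges gives a
   contradiction. *)

(** * Baire category on sequences of naturals *)

Definition overwrite (K : Type) (s : seq K) (x : nat -> K) : nat -> K :=
  fun i => nth (x i) s i.

(** A fixed-point equation rather than a statement about prefixes: it avoids a default element of
    [K] and lets cylinders be handled by rewriting. *)
Definition in_cylinder (K : Type) (s : seq K) (x : nat -> K) : Prop :=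
  overwrite s x = x.

Definition visits (K : Type) (D : set (seq K)) (x : nat -> K) : Prop :=
  exists n, D (mkseq x n).

Definition dense_below (K : Type) (s : seq K) (D : set (seq K)) : Prop :=
  forall t, exists t', D (s ++ t ++ t').

(** Each [visits (D n)] is open and dense for the product of the discrete topologies, so [A]
    contains a countable intersection of dense open sets, coded by finite sequences. *)
Definition comeager (K : Type) (A : set (nat -> K)) : Prop :=
  exists2 D : nat -> set (seq K), forall n, dense_below [::] (D n) &
    forall x, (forall n, visits (D n) x) -> A x.

Definition forces (K : Type) (s : seq K) (A : set (nat -> K)) : Prop :=
  comeager [set x | in_cylinder s x -> A x].

(** The combinatorial form of the Baire property: the cylinders in which [A] is comeager or meager
    are dense. *)
Definition baire_property (K : Type) (A : set (nat -> K)) : Prop :=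
  forall s, exists t, forces (s ++ t) A \/ forces (s ++ t) (~` A).

Section Sequences.
Variable K : Type.
Implicit Types (s t : seq K) (x y : nat -> K).

Lemma overwrite0 x : overwrite [::] x = x.
Proof. by apply/funext => i; rewrite /overwrite nth_nil. Qed.

Lemma overwrite_lt s x k0 i : (i < size s)%N -> overwrite s x i = nth k0 s i.
Proof. by move=> ilt; rewrite /overwrite (set_nth_default k0). Qed.

Lemma overwrite_ge s x i : (size s <= i)%N -> overwrite s x i = x i.
Proof. by move=> ige; rewrite /overwrite nth_default. Qed.

Lemma overwrite_same_size s s' t x : size s = size s' ->
  overwrite s (overwrite (s' ++ t) x) = overwrite (s ++ t) x.
Proof.
move=> ss; apply/funext => i; rewrite /overwrite !nth_cat -ss.
by case: ltnP => [lt|ge]; [exact: set_nth_default|rewrite nth_default].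
Qed.

Lemma overwrite_overwrite s s' x :
  overwrite s (overwrite s' x) = overwrite (s ++ drop (size s) s') x.
Proof.
apply/funext => i; rewrite /overwrite nth_cat nth_drop.
by case: ltnP => [ilt|ige]; [exact: set_nth_default|rewrite subnKC// nth_default].
Qed.

Lemma overwrite_id s x : in_cylinder s (overwrite s x).
Proof.
rewrite /in_cylinder overwrite_overwrite.
by rewrite drop_oversize// cats0.
Qed.

Lemma in_cylinder_cat s t x : in_cylinder (s ++ t) x -> in_cylinder s x.
Proof. by rewrite /in_cylinder => <-; rewrite overwrite_same_size. Qed.

Lemma in_cylinder_mkseq x n : in_cylinder (mkseq x n) x.
Proof.
apply/funext => i; have [ilt|ige] := ltnP i n.
  by rewrite /overwrite nth_mkseq.
by rewrite overwrite_ge// size_mkseq.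
Qed.

Lemma mkseq_cylinder s x : in_cylinder s x -> mkseq x (size s) = s.
Proof.
move=> sx; apply: (@eq_from_nth _ (x 0%N)); rewrite size_mkseq// => i ilt.
by rewrite nth_mkseq// -sx (overwrite_lt _ (x 0%N))// sx.
Qed.

Lemma mkseq_take x m n : (m <= n)%N -> mkseq x m = take m (mkseq x n).
Proof.
move=> mn; rewrite -[in RHS](subnKC mn) /mkseq iotaD map_cat.
by rewrite take_size_cat// size_map size_iota.
Qed.

Lemma mkseq_catD x m n :
  mkseq x (m + n) = mkseq x m ++ mkseq (fun i => x (m + i)%N) n.
Proof.
rewrite /mkseq iotaD map_cat; congr (_ ++ _).
by rewrite add0n -{1}[m]addn0 iotaDl -map_comp.
Qed.

Lemma mkseq_cylinder_cat s x n : in_cylinder s x -> (size s <= n)%N ->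
  exists t, mkseq x n = s ++ t.
Proof.
move=> sx le; exists (mkseq (fun i => x (size s + i)%N) (n - size s)).
by rewrite -(subnKC le) mkseq_catD mkseq_cylinder// addKn.
Qed.

Definition seq_lim (k0 : K) (S : nat -> seq K) : nat -> K :=
  fun i => nth k0 (S i.+1) i.

Lemma seq_limP k0 (S : nat -> seq K) :
  (forall n, exists2 t, S n.+1 = S n ++ t & (0 < size t)%N) ->
  forall n, in_cylinder (S n) (seq_lim k0 S).
Proof.
move=> step.
have grow n m : exists t, S (n + m)%N = S n ++ t.
  elim: m => [|m [t IH]]; first by exists [::]; rewrite addn0 cats0.
  have [t' e _] := step (n + m)%N; exists (t ++ t').
  by rewrite addnS e IH catA.
have large n : (n <= size (S n))%N.
  elim: n => // n IH; have [t -> tpos] := step n.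
  by rewrite size_cat -addn1 leq_add.
move=> n; apply/funext => i; have [ilt|ige] := ltnP i (size (S n)); last first.
  by rewrite overwrite_ge.
rewrite (overwrite_lt _ k0)// /seq_lim.
have nthS m p : (m <= p)%N -> (i < size (S m))%N -> nth k0 (S m) i = nth k0 (S p) i.
  by move=> /subnKC <- lt; have [t ->] := grow m (p - m)%N; rewrite nth_cat lt.
have [le|/ltnW le] := leqP n i.+1; first exact: nthS.
by rewrite (nthS i.+1 n)//; exact: large.
Qed.

End Sequences.

Section Category.
Implicit Types (s t : seq nat) (x y : nat -> nat) (A B : set (nat -> nat)).

Lemma baire (D : nat -> set (seq nat)) s : (forall n, dense_below s (D n)) ->
  exists2 x, in_cylinder s x & forall n, visits (D n) x.
Proof.
move=> dns.
have /choice[g gP] : forall p : nat * seq nat, exists t', D p.1 (s ++ p.2 ++ t').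
  by case=> n t; exact: dns.
(* The [rcons] makes each stage strictly longer, so that a limit exists even if [g] returns empty
   sequences. *)
pose T := fix T n := if n is n'.+1 then rcons (T n' ++ g (n', T n')) 0%N else [::].
have step n : exists2 t, s ++ T n.+1 = (s ++ T n) ++ t & (0 < size t)%N.
  exists (rcons (g (n, T n)) 0%N); last by rewrite size_rcons.
  by rewrite /= -!cats1 !catA.
have lim := seq_limP 0%N step.
exists (seq_lim 0%N (fun n => s ++ T n)).
  by have := lim 0%N; rewrite cats0.
move=> n; exists (size (s ++ T n ++ g (n, T n))).
rewrite mkseq_cylinder; first exact: (gP (n, T n)).
by apply: (@in_cylinder_cat _ _ [:: 0%N]); have := lim n.+1; rewrite /= -cats1 !catA.
Qed.

Lemma sub_comeager A B : A `<=` B -> comeager A -> comeager B.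
Proof. by move=> AB [D dns DA]; exists D => // x /DA /AB. Qed.

Lemma comeager_bigcap (I : countType) (A : I -> set (nat -> nat)) :
  (forall i, comeager (A i)) -> comeager (\bigcap_i A i).
Proof.
move=> cA.
have /choice[D DP] : forall i, exists D : nat -> set (seq nat),
    (forall n, dense_below [::] (D n)) /\
    (forall x, (forall n, visits (D n) x) -> A i x).
  by move=> i; have [D ? ?] := cA i; exists D.
exists (fun n => if unpickle n is Some (i, m) then D i m else setT).
  move=> n; case: (unpickle n) => [[i m]|]; first exact: (DP i).1.
  by move=> t; exists [::].
move=> x xD i _; apply: (DP i).2 => n.
by have := xD (pickle (i, n)); rewrite pickleK.
Qed.

Lemma comeager_dense A s : comeager A -> exists2 x, in_cylinder s x & A x.
Proof.
move=> [D dns DA]; have [|x sx xD] := @baire D s.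
  by move=> n t; have [t' Dt] := dns n (s ++ t); exists t'; rewrite catA.
by exists x => //; exact: DA.
Qed.

Lemma comeager_visits (D : set (seq nat)) : dense_below [::] D -> comeager (visits D).
Proof. by move=> dns; exists (fun=> D) => // x /(_ 0%N). Qed.

(** Replacing the first [size r] entries by [r] pulls dense sets back to dense sets; only sequences
    at least as long as [r] are kept, so that the replacement is complete. *)
Lemma comeager_overwrite r A : comeager A -> comeager [set x | A (overwrite r x)].
Proof.
move=> [D dns DA].
exists (fun n => [set s | (size r <= size s)%N /\ D n (r ++ drop (size r) s)]).
  move=> n t /=.
  pose p := nseq (size r) 0%N.
  have [t' Dt] := dns n (r ++ drop (size r) (t ++ p)).
  exists (p ++ t'); rewrite catA; split.
    by rewrite !size_cat size_nseq -addnA addnCA leq_addr.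
  rewrite drop_cat; case: ltnP.
    by move: Dt; rewrite /= -!catA.
  rewrite size_cat size_nseq => le.
  have t0 : t = [::] by apply/nilP; rewrite /nilp; case: (size t) le => // m; rewrite addSn ltnNge leq_addl.
  move: Dt; rewrite t0 /= add0n subnn drop0 drop_oversize ?size_nseq//.
  by rewrite cats0.
move=> x xD; apply: DA => n; have [m [le Dm]] := xD n.
rewrite size_mkseq in le; exists m.
suff -> : mkseq (overwrite r x) m = r ++ drop (size r) (mkseq x m) by [].
apply: (@eq_from_nth _ 0%N).
  by rewrite size_mkseq size_cat size_drop size_mkseq subnKC.
rewrite size_mkseq => i im; rewrite nth_mkseq// nth_cat nth_drop.
case: ltnP => ir; first exact: overwrite_lt.
by rewrite subnKC// nth_mkseq// overwrite_ge.
Qed.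

Lemma sub_forces s A B : A `<=` B -> forces s A -> forces s B.
Proof. by move=> AB; apply: sub_comeager => x /= h /h /AB. Qed.

Lemma forces_all s A : (forall x, in_cylinder s x -> A x) -> forces s A.
Proof.
move=> sA; exists (fun=> setT); first by move=> _ t; exists [::].
by move=> x _ /sA.
Qed.

Lemma forces_nonempty s A : forces s A -> A !=set0.
Proof. by move=> /(comeager_dense s)[x sx /(_ sx)]; exists x. Qed.

Lemma forces_bigcap (I : countType) s (A : I -> set (nat -> nat)) :
  (forall i, forces s (A i)) -> forces s (\bigcap_i A i).
Proof.
move=> sA; have := comeager_bigcap sA; apply: sub_comeager => x /= xA sx i _.
exact: xA.
Qed.

End Category.

(** * The Baire property and generic continuity *)

Section BaireProperty.
Implicit Types (s t : seq nat) (x y : nat -> nat) (A B : set (nat -> nat)).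

(** Almost every point of the cylinder of [s] passes through some [u] that forces [A]. There are
    countably many such [u], so their exceptional meager sets can be discarded together. *)
Lemma forces_locally s A : (forall t, exists t', forces (s ++ t ++ t') A) ->
  forces s A.
Proof.
move=> loc.
pose D := [set u | (size s <= size u)%N /\ (prefix s u -> forces u A)].
have dD : dense_below [::] D.
  move=> t /=; pose p := nseq (size s) 0%N.
  have le : (size s <= size (t ++ p))%N by rewrite size_cat size_nseq leq_addl.
  have [/prefixP[t' tE]|npre] := boolP (prefix s (t ++ p)); last first.
    by exists p; split => // /(negP npre).
  have [t'' f] := loc t'; exists (p ++ t''); rewrite catA tE -catA; split => //.
  by rewrite size_cat leq_addr.
have c1 := comeager_visits dD.
have c2 : comeager (\bigcap_(u in setT) [set x | forces u A -> in_cylinder u x -> A x]).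
  apply: comeager_bigcap => u; have [fA|nfA] := pselect (forces u A).
    by apply: sub_comeager fA => x /= h _.
  by exists (fun=> setT) => [_ t|x _ /nfA//]; exists [::].
have c : comeager (\bigcap_(b in setT) if b then visits D else
    (\bigcap_(u in setT) [set x | forces u A -> in_cylinder u x -> A x])).
  by apply: comeager_bigcap => -[].
apply: sub_comeager c => x /= h sx.
have [n [le f]] := h true I.
apply: (h false I (mkseq x n)) => //; last exact: in_cylinder_mkseq.
apply: f; have [t ->] := mkseq_cylinder_cat sx (n := n) ltac:(by rewrite size_mkseq in le).
exact: prefix_prefix.
Qed.

Lemma baire_propertyC A : baire_property A -> baire_property (~` A).
Proof.
by move=> bA s; have [t [f|f]] := bA s; exists t; [right; rewrite setCK|left].
Qed.

(** If no extension of [s] forces any [A n], then below [s] the complement of each [A n] is forced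
    densely often, hence by [s] itself, and countably many forced sets can be intersected. *)
Lemma baire_property_bigcup (A : nat -> set (nat -> nat)) :
  (forall n, baire_property (A n)) -> baire_property (\bigcup_n A n).
Proof.
move=> bA s.
have [[n [t f]]|none] := pselect (exists n t, forces (s ++ t) (A n)).
  by exists t; left; apply: sub_forces f => x Ax; exists n.
exists [::]; right; rewrite cats0 setC_bigcup; apply: forces_bigcap => n.
apply: forces_locally => t; have [t' [f|f]] := bA n (s ++ t).
  by case: none; exists n, (t ++ t'); rewrite catA.
by exists t'; rewrite catA.
Qed.

Lemma baire_property_open A :
  (forall x, A x -> exists n, forall y, in_cylinder (mkseq x n) y -> A y) ->
  baire_property A.
Proof.
move=> oA s.
have [[t f]|none] := pselect (exists t, forall x, in_cylinder (s ++ t) x -> A x).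
  by exists t; left; exact: forces_all.
exists [::]; right; rewrite cats0; apply: forces_all => x sx Ax; apply: none.
have [n nA] := oA x Ax.
have [t tE] := mkseq_cylinder_cat sx (leq_maxr n (size s)).
exists t => y; rewrite -tE => cy; apply: nA.
have [t' t'E] := mkseq_cylinder_cat (in_cylinder_mkseq x n) (n := maxn n (size s)) ltac:(by rewrite size_mkseq leq_maxl).
by apply: (@in_cylinder_cat _ _ t'); rewrite -t'E.
Qed.

Lemma baire_property_sigma : sigma_algebra setT (@baire_property nat).
Proof.
split.
- by move=> s; exists [::]; right; apply: forces_all => x _ [].
- by move=> A bA; rewrite setTD; exact: baire_propertyC.
- exact: baire_property_bigcup.
Qed.

(** Otherwise [s] would force [T] to avoid every natural number at once. *)
Lemma decide_value (T : (nat -> nat) -> nat) s :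
  (forall v, baire_property [set x | T x = v]) ->
  exists t v, forces (s ++ t) [set x | T x = v].
Proof.
move=> bT; apply: contrapT => none.
have f : forces s (\bigcap_v ~` [set x | T x = v]).
  apply: forces_bigcap => v; apply: forces_locally => t.
  have [t' [f|f]] := bT v (s ++ t).
    by case: none; exists (t ++ t'), v; rewrite catA.
  by exists t'; rewrite catA.
by have [x /(_ (T x) Logic.I)] := forces_nonempty f; exact.
Qed.

(* On a comeager set that is invariant under finite modifications, every map
   with the Baire property and discrete range is locally constant. *)
Lemma generic_continuity (T : nat -> (nat -> nat) -> nat) :
  (forall i v, baire_property [set x | T i x = v]) ->
  exists C : set (nat -> nat), [/\ comeager C,
    forall r x, C x -> C (overwrite r x) &
    forall i x, C x -> exists n,
      forall y, C y -> in_cylinder (mkseq x n) y -> T i y = T i x].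
Proof.
move=> bT.
(* The points at which every forced value is the actual one and each [T i] is decided by an initial
   segment. *)
pose C1 := [set x | (forall i s v, forces s [set x | T i x = v] ->
    in_cylinder s x -> T i x = v) /\
  forall i, exists n v, forces (mkseq x n) [set x | T i x = v]].
have cC1 : comeager C1.
  pose A (p : nat + nat * seq nat * nat) : set (nat -> nat) := match p with
    | inl i => visits [set s | exists v, forces s [set x | T i x = v]]
    | inr (i, s, v) => [set x | forces s [set x | T i x = v] ->
                                in_cylinder s x -> T i x = v]
    end.
  have cA : comeager (\bigcap_(p in setT) A p).
    apply: comeager_bigcap => -[i|[[i s] v]] /=.
      by apply: comeager_visits => t /=; exact: decide_value.
    have [f|nf] := pselect (forces s [set x | T i x = v]).
      by apply: sub_comeager f => x /= h _.
    by exists (fun=> setT) => [_ t|x _ /nf//]; exists [::].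
  apply: sub_comeager cA => x xA; split => [i s v|i].
    exact: (xA (inr (i, s, v))).
  exact: (xA (inl i)).
(* Keeping the points all of whose finite modifications lie in [C1] gives the invariance. *)
exists (\bigcap_(r in setT) [set x | C1 (overwrite r x)]); split.
- by apply: comeager_bigcap => r; exact: comeager_overwrite.
- by move=> r x Cx r' _ /=; rewrite overwrite_overwrite; exact: Cx.
move=> i x /(_ [::] Logic.I) /=; rewrite overwrite0 => -[xv xf].
have [n [v f]] := xf i; exists n => y /(_ [::] Logic.I) /=.
rewrite overwrite0 => -[yv _] cy.
by rewrite (yv _ _ _ f cy) (xv _ _ _ f (in_cylinder_mkseq x n)).
Qed.

(** Baire category inside [C], for a cover by relatively closed sets. If no [F n] contained the part
    of [C] in some smaller cylinder, the sequences whose cylinder misses [F n] inside [C] would be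
    dense below [s] for every [n], and a point of [C] visiting them all would be uncovered. *)
Lemma comeager_relative_baire (C : set (nat -> nat)) (F : nat -> set (nat -> nat)) s :
  comeager C -> (forall x, C x -> in_cylinder s x -> exists n, F n x) ->
  (forall n x, C x -> ~ F n x -> exists m, forall y, C y ->
     in_cylinder (mkseq x m) y -> ~ F n y) ->
  exists t n, forall x, C x -> in_cylinder (s ++ t) x -> F n x.
Proof.
move=> cC cov clo; apply: contrapT => none.
have dns n : dense_below s [set u | forall y, C y -> in_cylinder u y -> ~ F n y].
  move=> t; have [x [Cx stx nFx]] : exists x, [/\ C x, in_cylinder (s ++ t) x & ~ F n x].
    apply: contrapT => h; apply: none; exists t, n => x Cx stx.
    by apply: contrapT => nF; apply: h; exists x.
  have [m mP] := clo n x Cx nFx.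
  have [t' t'E] := mkseq_cylinder_cat stx (leq_maxr m (size (s ++ t))).
  exists t' => y Cy /=; rewrite catA -t'E => cy; apply: mP => //.
  have [t'' t''E] := mkseq_cylinder_cat (in_cylinder_mkseq x m) (n := maxn m (size (s ++ t))) ltac:(by rewrite size_mkseq leq_maxl).
  by apply: (@in_cylinder_cat _ _ t''); rewrite -t''E.
have [D dD DC] := cC.
(* Odd indices keep the point in [C], even indices take it out of every [F n]. *)
have [|x sx xD] := @baire (fun n => if odd n then D n./2 else
    [set u | forall y, C y -> in_cylinder u y -> ~ F n./2 y]) s.
  move=> n; case: (odd n) => // t.
  by have [t' Dt] := dD n./2 (s ++ t); exists t'; rewrite catA.
have Cx : C x.
  by apply: DC => n; have := xD n.*2.+1; rewrite /= odd_double uphalf_double.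
have [n Fx] := cov x Cx sx; have := xD n.*2; rewrite odd_double doubleK => -[m /= mP].
exact: (mP x Cx (in_cylinder_mkseq x m)).
Qed.

End BaireProperty.

(** * Fusion *)

Lemma in_cylinder_mkseqP (x y : nat -> nat) m :
  in_cylinder (mkseq x m) y <-> forall i, (i < m)%N -> y i = x i.
Proof.
split => [<- i im|h].
  by rewrite (overwrite_lt _ 0%N) ?size_mkseq// nth_mkseq.
apply/funext => i; have [im|mi] := ltnP i m.
  by rewrite (overwrite_lt _ 0%N) ?size_mkseq// nth_mkseq// h.
by rewrite overwrite_ge// size_mkseq.
Qed.

Lemma extend_finitely (A : eqType) (H : seq A) (Q : A -> set (seq nat)) :
  (forall a t t', Q a t -> Q a (t ++ t')) ->
  (forall a, a \in H -> forall t, exists t', Q a (t ++ t')) ->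
  forall t, exists t', forall a, a \in H -> Q a (t ++ t').
Proof.
move=> Qext; elim: H => [|a H IH] dns t; first by exists [::].
have [t' Q't] := IH (fun b bH => dns b (mem_behead (s := a :: H) bH)) t.
have [t'' Qat] := dns a (mem_head a H) (t ++ t').
exists (t' ++ t'') => b; rewrite in_cons catA => /orP[/eqP-> //|bH].
exact/Qext/Q't.
Qed.

Lemma finite_upper_bound (A : eqType) (H : seq A) (P : A -> nat -> Prop) n0 :
  (forall a m n, (m <= n)%N -> P a m -> P a n) ->
  (forall a, a \in H -> exists n, P a n) ->
  exists2 n, (n0 <= n)%N & forall a, a \in H -> P a n.
Proof.
move=> Pmono; elim: H => [|a H IH] ex; first by exists n0.
have [n n0n nP] := IH (fun b bH => ex b (mem_behead (s := a :: H) bH)).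
have [m mP] := ex a (mem_head a H).
exists (maxn n m); first by rewrite leq_max n0n.
move=> b; rewrite in_cons => /orP[/eqP->|bH].
  by apply: Pmono mP; exact: leq_maxr.
by apply: Pmono (nP b bH); exact: leq_maxl.
Qed.

Lemma bounded_series_tail (R : realType) (a : nat -> R) (M eps : R) :
  0 < eps -> (forall i, 0 <= a i) -> (forall n, \sum_(0 <= i < n) a i <= M) ->
  exists L, forall n, \sum_(L <= i < n) a i <= eps.
Proof.
move=> eps0 a0 aM; pose E := range (fun n => \sum_(0 <= i < n) a i).
have hE : has_sup E.
  by split; [exists (\sum_(0 <= i < 0) a i), 0%N|exists M => _ [n _ <-]].
have [_ [L _ <-] lt] := sup_adherent eps0 hE.
exists L => n; have [nL|Ln] := leqP n L; first by rewrite big_geq// ltW.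
have := ub_le_sup hE.2 (imageP (fun n => \sum_(0 <= i < n) a i) (I : setT n)).
by rewrite /= (@big_cat_nat _ _ _ L)//= ?(ltnW Ln)//; move: lt; rewrite /E; move: (sup _) => S_; lra.
Qed.

Section Fusion.
Variables (R : realType) (T : nat -> (nat -> nat) -> nat).
Variable w : nat -> nat -> nat -> R.
Hypothesis w_ge0 : forall i u v, 0 <= w i u v.
Hypothesis w_refl : forall i v, w i v v = 0.
Hypothesis w_tail : forall x y, (exists n, forall m, (n <= m)%N -> x m = y m) ->
  exists M, forall n, \sum_(0 <= i < n) w i (T i x) (T i y) <= M.
Variable C : set (nat -> nat).
Hypothesis comC : comeager C.
Hypothesis overC : forall r x, C x -> C (overwrite r x).
Hypothesis constC : forall i x, C x -> exists n,
  forall y, C y -> in_cylinder (mkseq x n) y -> T i y = T i x.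

Let close (L : nat) (eps : R) (x y : nat -> nat) : Prop :=
  forall n, \sum_(L <= i < n) w i (T i x) (T i y) <= eps.

Let close_mono eps x y L L' : (L <= L')%N -> close L eps x y -> close L' eps x y.
Proof.
move=> LL' cl n; have [nL|Ln] := leqP n L'.
  by rewrite big_geq//; apply: le_trans (cl L); rewrite big_geq.
apply: le_trans (cl n); rewrite [leRHS](@big_cat_nat _ _ _ L')//= ?(ltnW Ln)//.
by rewrite lerDr; apply: sumr_ge0.
Qed.

Let constC_upto r L x : C x -> exists m, forall y, C y ->
  in_cylinder (mkseq x m) y -> forall i, (i < L)%N ->
  T i (overwrite r y) = T i (overwrite r x).
Proof.
move=> Cx; elim: L => [|L [m mP]]; first by exists 0%N.
have [n nP] := constC L (overC r Cx).
exists (maxn m n) => y Cy /in_cylinder_mkseqP yx i.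
rewrite ltnS leq_eqVlt => /orP[/eqP->|].
  apply: nP; first exact: overC.
  apply/in_cylinder_mkseqP => k kn; rewrite /overwrite yx//.
  by rewrite leq_max kn orbT.
by apply: mP => //; apply/in_cylinder_mkseqP => k km; rewrite yx// leq_max km.
Qed.

(** By [w_tail], two points that differ only in their heads have images at finite total distance, so
    some tail of the sum is at most [eps]. The index where this tail starts depends on the point;
    for a fixed index the condition is relatively closed, so category makes the index uniform on a
    smaller cylinder. *)
Let settle_tail h h' eps t : size h = size h' -> 0 < eps ->
  exists t' L, forall x, C x ->
    close L eps (overwrite (h ++ t ++ t') x) (overwrite (h' ++ t ++ t') x).
Proof.
move=> hh' eps0.
have [||t' [L tL]] := @comeager_relative_baire C
  (fun L => [set y | close L eps y (overwrite (h' ++ t) y)]) (h ++ t) comC.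
- move=> x Cx _; have [|M xM] := @w_tail x (overwrite (h' ++ t) x).
    by exists (size (h' ++ t)) => m le; rewrite overwrite_ge.
  have [L LP] := bounded_series_tail eps0 (fun i => w_ge0 i _ _) xM.
  by exists L.
- move=> L x Cx /= /existsNP[n nP].
  have [m1 P1] := constC_upto [::] n Cx; have [m2 P2] := constC_upto (h' ++ t) n Cx.
  exists (maxn m1 m2) => y Cy /in_cylinder_mkseqP yx /(_ n); apply: contra_not nP.
  apply: le_trans; rewrite le_eqVlt; apply/orP; left; apply/eqP.
  apply: eq_big_nat => i /andP[_ ilt].
  have := P1 y Cy; rewrite !overwrite0 => -> //; last first.
    by apply/in_cylinder_mkseqP => k km; rewrite yx// leq_max km.
  by rewrite P2//; apply/in_cylinder_mkseqP => k km; rewrite yx// leq_max km orbT.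
exists t', L => x Cx; have := tL (overwrite (h ++ t ++ t') x) (overC _ Cx).
rewrite -catA => /(_ (@overwrite_id _ _ _)) /=.
by rewrite catA (catA h') overwrite_same_size// !size_cat hh'.
Qed.

Let settle_value i h t : exists t', forall x y, C x -> C y ->
  T i (overwrite (h ++ t ++ t') x) = T i (overwrite (h ++ t ++ t') y).
Proof.
have [x hx Cx] := comeager_dense (h ++ t) comC.
have [n nP] := constC i Cx.
have [t' t'E] := mkseq_cylinder_cat hx (leq_maxr n (size (h ++ t))).
have key y : C y -> T i (overwrite (h ++ t ++ t') y) = T i x.
  move=> Cy; apply: nP; first exact: overC.
  apply/in_cylinder_mkseqP => k kn; rewrite catA -t'E.
  have klt : (k < maxn n (size (h ++ t)))%N by rewrite leq_max kn.
  by rewrite (overwrite_lt _ 0%N) ?size_mkseq// nth_mkseq.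
by exists t' => y z Cy Cz; rewrite !key.
Qed.

(** One extension has to serve all heads. First the tails of all pairs are settled, which determines
    [L]; then the finitely many values of index below [L]; then the visit to [D]. Each of these
    survives further extension. *)
Let fusion_step (D : set (seq nat)) (H : seq (seq nat)) l L0 eps :
  dense_below [::] D -> (forall h, h \in H -> size h = l) -> 0 < eps ->
  exists t L, (L0 <= L)%N /\ forall h, h \in H -> [/\
    exists n, D (take n (h ++ t)),
    forall x y i, C x -> C y -> (i < L)%N ->
      T i (overwrite (h ++ t) x) = T i (overwrite (h ++ t) y) &
    forall h', h' \in H -> forall x, C x ->
      close L eps (overwrite (h ++ t) x) (overwrite (h' ++ t) x)].
Proof.
move=> dD szH eps0.
pose Q1 (a : seq nat * seq nat) L t := forall x, C x ->
  close L eps (overwrite (a.1 ++ t) x) (overwrite (a.2 ++ t) x).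
have ext1 a L t t' : a \in [seq (h, h') | h <- H, h' <- H] -> Q1 a L t -> Q1 a L (t ++ t').
  move=> /allpairsP[[h h'] /= [hH h'H ->]] q x Cx.
  have := q _ (overC (h ++ t ++ t') Cx) => /=.
  by rewrite !catA !overwrite_same_size ?size_cat ?(szH _ hH) ?(szH _ h'H).
have [t1 t1P] := @extend_finitely _ [seq (h, h') | h <- H, h' <- H]
   (fun a t => a \in [seq (h, h') | h <- H, h' <- H] -> exists L, Q1 a L t)
   ltac:(by move=> {}a t t' q /[dup] aH /q[L qL]; exists L; exact: ext1)
   ltac:(by move=> {}a /[dup] aH /allpairsP[[h h'] /= [hH h'H ->]] t;
     have [t' [L tL]] := @settle_tail h h' eps t ltac:(by rewrite !szH) eps0;
     exists t' => _; exists L) [::].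
have [L L0L LP] := @finite_upper_bound _ [seq (h, h') | h <- H, h' <- H]
   (fun a L => Q1 a L t1) L0 ltac:(by move=> a m n mn q x Cx; exact: close_mono mn (q x Cx))
   ltac:(by move=> a aH; exact: t1P).
have [t2 t2P] := @extend_finitely _ [seq (h, i) | h <- H, i <- iota 0 L]
   (fun a t => forall x y, C x -> C y ->
      T a.2 (overwrite (a.1 ++ t) x) = T a.2 (overwrite (a.1 ++ t) y))
   ltac:(by move=> [h i] t t' q x y Cx Cy /=;
     have := q _ _ (overC (h ++ t ++ t') Cx) (overC (h ++ t ++ t') Cy);
     rewrite /= !catA !overwrite_same_size)
   ltac:(by move=> [h i] _ t; exact: settle_value) t1.
have [t3 t3P] := @extend_finitely _ H
   (fun h t => exists n, D (take n (h ++ t)))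
   ltac:(by move=> h t t' [n nD]; exists (minn n (size (h ++ t)));
     rewrite catA takel_cat ?geq_minr//; case: (leqP n (size (h ++ t))) => // nle;
     rewrite take_oversize// in nD; [rewrite take_size|exact: ltnW])
   ltac:(by move=> h _ t; have [t' Dt] := dD (h ++ t); exists t', (size (h ++ t ++ t'));
     rewrite take_size catA) (t1 ++ t2).
exists ((t1 ++ t2) ++ t3), L; split => // h hH; split.
- exact: t3P.
- move=> x y i Cx Cy iL.
  have hi : (h, i) \in [seq (h, i) | h <- H, i <- iota 0 L].
    by apply/allpairsP; exists (h, i); rewrite mem_iota.
  have := t2P _ hi _ _ (overC (h ++ (t1 ++ t2) ++ t3) Cx) (overC (h ++ (t1 ++ t2) ++ t3) Cy).
  by rewrite /= !catA !overwrite_same_size.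
- move=> h' h'H x Cx; rewrite -catA.
  have aH : (h, h') \in [seq (h, h') | h <- H, h' <- H] by exact: allpairs_f.
  exact: (ext1 _ _ _ _ aH (LP _ aH)).
Qed.

Variables (F : nat -> seq nat) (eps : nat -> R).
Hypothesis eps_gt0 : forall j, 0 < eps j.

(** [e z] carries the free entry [z j] at position [b j], all other entries being fixed. The filler
    after a free position meets the next dense set, freezes the outputs below the next cutoff and
    makes later outputs nearly independent of the entries chosen so far. Hence, up to an error
    [eps j], the outputs from [L j] to [L j.+1] see only [z j]. *)
Lemma generic_fusion : exists (e : (nat -> nat) -> nat -> nat) (b L : nat -> nat),
  [/\ injective b,
    forall z j, e z (b j) = z j,
    forall z z' i, (forall j, b j != i) -> e z i = e z' i,
    L 0%N = 0%N /\ (forall j, (L j < L j.+1)%N) &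
    forall z z' j, (forall i, z i \in F i) -> (forall i, z' i \in F i) ->
      ((forall i, (j <= i)%N -> z i = z' i) -> forall n,
        \sum_(L j <= i < n) w i (T i (e z)) (T i (e z')) <= eps j) /\
      ((forall i, (i < j)%N -> z i = z' i) -> forall i, (i < L j)%N ->
        T i (e z) = T i (e z'))].
Proof.
have [D dD DC] := comC.
pose heads (H : seq (seq nat)) j := [seq rcons r p | r <- H, p <- F j].
have /choice[step stepP] : forall a : nat * nat * seq (seq nat) * nat,
    exists tL : seq nat * nat, let: (j, l, H, L0) := a in
    (forall h, h \in H -> size h = l) ->
    (L0 < tL.2)%N /\ forall h, h \in heads H j -> [/\
      exists n, D j (take n (h ++ tL.1)),
      forall x y i, C x -> C y -> (i < tL.2)%N ->
        T i (overwrite (h ++ tL.1) x) = T i (overwrite (h ++ tL.1) y) &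
      forall h', h' \in heads H j -> forall x, C x ->
        close tL.2 (eps j.+1) (overwrite (h ++ tL.1) x) (overwrite (h' ++ tL.1) x)].
  move=> [[[j l] H] L0].
  have [szH|] := pselect (forall h, h \in H -> size h = l); last by exists ([::], 0%N).
  have szh h : h \in heads H j -> size h = l.+1.
    by move=> /allpairsP[[r p] /= [rH _ ->]]; rewrite size_rcons szH.
  have [t [L LP]] := fusion_step L0.+1 (dD j) szh (eps_gt0 j.+1).
  by exists (t, L).
(* The state at stage [j] consists of the next free position [b j], the list of all heads of that
   length, and the cutoff [L j]. *)
pose next j (a : nat * seq (seq nat) * nat) :=
  let tL := step (j, a.1.1, a.1.2, a.2) in
  ((a.1.1 + size tL.1).+1, [seq h ++ tL.1 | h <- heads a.1.2 j], tL.2).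
pose st := fix st j := if j is j'.+1 then next j' (st j') else (0%N, [:: [::]], 0%N).
pose b j := (st j).1.1; pose H j := (st j).1.2; pose L j := (st j).2.
pose tl j := (step (j, b j, H j, L j)).1.
have HS j : H j.+1 = [seq h ++ tl j | h <- heads (H j) j] by [].
have bS j : b j.+1 = (b j + size (tl j)).+1 by [].
have szH j h : h \in H j -> size h = b j.
  elim: j h => [|j IH] h; first by rewrite inE => /eqP->.
  rewrite HS => /mapP[_ /allpairsP[[r p] /= [rH _ ->]] ->].
  by rewrite size_cat size_rcons (IH _ rH) bS addSn.
have stP j := stepP (j, b j, H j, L j) (@szH j).
have settled j h : h \in H j ->
    (forall x y i, C x -> C y -> (i < L j)%N ->
      T i (overwrite h x) = T i (overwrite h y)) /\
    forall h', h' \in H j -> forall x, C x ->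
      close (L j) (eps j) (overwrite h x) (overwrite h' x).
  (* At stage 0 the only head is empty, and closeness reduces to [w_refl]. *)
  case: j => [|j].
    rewrite inE => /eqP->; split => // h'; rewrite inE => /eqP-> x Cx n.
    by rewrite big1 ?ltW// => i _; exact: w_refl.
  rewrite HS => /mapP[g gH ->]; have [_ hP] := stP j.
  have [_ h2 h3] := hP _ gH; split => // _ /mapP[g' g'H ->]; exact: h3.
pose S z := fix S j := if j is j'.+1 then rcons (S j') (z j') ++ tl j' else [::].
have SS z j : S z j.+1 = rcons (S z j) (z j) ++ tl j by [].
have szS z j : size (S z j) = b j.
  by elim: j => // j IH; rewrite SS size_cat size_rcons IH bS addSn.
pose e z := seq_lim 0%N (S z).
have eS z j : in_cylinder (S z j) (e z).
  apply: seq_limP => n; exists (z n :: tl n) => //.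
  by rewrite SS -cats1 -catA.
have nthS z j i : (i < b j)%N -> e z i = nth 0%N (S z j) i.
  by move=> ij; rewrite -[in LHS](eS z j) (overwrite_lt _ 0%N)// szS.
have bhomo : {homo b : i j / (i < j)%N}.
  by apply: homo_ltn => [|j]; [exact: ltn_trans|rewrite bS ltnS leq_addr].
have binj : injective b.
  move=> i j bij; have [ij|ji|//] := ltngtP i j.
    by have := bhomo _ _ ij; rewrite bij ltnn.
  by have := bhomo _ _ ji; rewrite bij ltnn.
have eb z j : e z (b j) = z j.
  rewrite (nthS z j.+1) ?bS ?ltnS ?leq_addr//.
  by rewrite SS nth_cat size_rcons szS ltnSn nth_rcons szS ltnn eqxx.
have bge j : (j <= b j)%N.
  by elim: j => // j IH; apply: leq_ltn_trans IH (bhomo _ _ (ltnSn j)).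
have efix z z' i : (forall j, b j != i) -> e z i = e z' i.
  move=> bi; have ilt : (i < b i.+1)%N by exact: bge.
  rewrite !(nthS _ i.+1)//; elim: i.+1 ilt => // j IH ilt.
  rewrite !SS !nth_cat !size_rcons !szS !nth_rcons !szS.
  have := bi j; case: (ltngtP i (b j)) => [ij _|ji _|->] //.
  by rewrite (leq_trans ij)// IH.
have SH z j : (forall i, z i \in F i) -> S z j \in H j.
  move=> zF; elim: j => // j IH; rewrite HS SS; apply/mapP.
  by exists (rcons (S z j) (z j)) => //; apply/allpairsP; exists (S z j, z j); split => //=.
have eC z : (forall i, z i \in F i) -> C (e z).
  move=> zF; apply: DC => j; have [_ hP] := stP j.
  have [|[n nD] _ _] := hP (rcons (S z j) (z j)).
    by apply/allpairsP; exists (S z j, z j); split => //=; exact: SH.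
  rewrite -/(tl j) -SS in nD.
  have [nle|nge] := leqP n (size (S z j.+1)).
    by exists n; rewrite (mkseq_take _ nle) mkseq_cylinder.
  by exists (size (S z j.+1)); rewrite mkseq_cylinder// -(take_oversize (ltnW nge)).
exists e, b, L; split => //.
  by split=> // j; have [] := stP j.
move=> z z' j zF z'F; split => zz'.
  have [_ hP] := settled j _ (SH z j zF).
  have := hP _ (SH z' j z'F) _ (eC z zF).
  rewrite (eS z j).
  (* The fillers are common and the free entries agree from stage [j] on, so the two points differ
     only in their heads. *)
  suff -> : overwrite (S z' j) (e z) = e z' by [].
  rewrite -[RHS](eS z' j); apply/funext => i; have [ilt|ige] := ltnP i (b j).
    by rewrite !(overwrite_lt _ 0%N) ?szS.
  rewrite !overwrite_ge ?szS//.
  have [[k kE]|none] := pselect (exists k, b k = i).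
    rewrite -kE in ige *; rewrite !eb zz'// leqNgt; apply/negP => kj.
    by have := bhomo _ _ kj; rewrite ltnNge ige.
  by apply: efix => k; apply/eqP => bk; apply: none; exists k.
move=> i iL; have [h _] := settled j _ (SH z j zF).
have SE : S z j = S z' j.
  elim: j zz' {h iL} => // j IH zz'; rewrite !SS zz'// IH// => k kj.
  by apply: zz'; rewrite ltnW.
by rewrite -(eS z j) -(eS z' j) -SE; apply: h => //; exact: eC.
Qed.

End Fusion.

Lemma fusion (R : realType) (T : nat -> (nat -> nat) -> nat)
    (w : nat -> nat -> nat -> R) (F : nat -> seq nat) (eps : nat -> R) :
  (forall i v, baire_property [set x | T i x = v]) ->
  (forall i u v, 0 <= w i u v) -> (forall i v, w i v v = 0) ->
  (forall x y, (exists n, forall m, (n <= m)%N -> x m = y m) ->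
    exists M, forall n, \sum_(0 <= i < n) w i (T i x) (T i y) <= M) ->
  (forall j, 0 < eps j) ->
  exists (e : (nat -> nat) -> nat -> nat) (b L : nat -> nat),
  [/\ injective b,
    forall z j, e z (b j) = z j,
    forall z z' i, (forall j, b j != i) -> e z i = e z' i,
    L 0%N = 0%N /\ (forall j, (L j < L j.+1)%N) &
    forall z z' j, (forall i, z i \in F i) -> (forall i, z' i \in F i) ->
      ((forall i, (j <= i)%N -> z i = z' i) -> forall n,
        \sum_(L j <= i < n) w i (T i (e z)) (T i (e z')) <= eps j) /\
      ((forall i, (i < j)%N -> z i = z' i) -> forall i, (i < L j)%N ->
        T i (e z) = T i (e z'))].
Proof.
move=> bT w0 wr wt e0; have [C [cC oC kC]] := generic_continuity bT.
exact: (generic_fusion w0 wr wt cC oC kC).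
Qed.

(** * Gauges *)

Lemma itv01P (R : realType) (x : R) : `[0, 1]%classic x <-> 0 <= x <= 1.
Proof. by rewrite /= in_itv. Qed.

(** The slope condition is cleared of denominators so that it includes [x = 0]; one constant serves
    both inequalities. *)
Record gauge (R : realType) (C : R) (g : R -> R) : Prop := Gauge {
  gauge0 : g 0 = 0;
  gauge_gt0 : forall x, 0 < x -> x <= 1 -> 0 < g x;
  gauge_ge1 : 1 <= C;
  gauge_slope : forall x y, 0 <= x -> x <= y -> y <= 1 -> y * g x <= C * (x * g y);
  gauge_mul : forall x y, 0 <= x <= 1 -> 0 <= y <= 1 -> g x * g y <= C * g (x * y)
}.

Section GaugeTheory.
Variables (R : realType) (C : R) (g : R -> R).
Hypothesis gC : gauge C g.
Implicit Types x y z : R.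

Let C1 : 1 <= C. Proof. exact: gauge_ge1 gC. Qed.

Lemma gauge_ge0 x : 0 <= x <= 1 -> 0 <= g x.
Proof.
move=> /andP[]; rewrite le_eqVlt => /orP[/eqP<- _|x0 x1]; first by rewrite (gauge0 gC).
exact/ltW/(gauge_gt0 gC).
Qed.

Lemma gauge_incr x y : 0 <= x -> x <= y -> y <= 1 -> g x <= C * g y.
Proof.
move=> x0 xy y1; have [y0|yn0] := ltP 0 y; last first.
  have -> : x = y by lra.
  by rewrite ler_peMl ?gauge_ge0//; lra.
have := gauge_slope gC x0 xy y1.
have gy : 0 <= g y by rewrite gauge_ge0//; lra.
have h : C * (x * g y) <= y * (C * g y).
  by rewrite mulrCA ler_wpM2r// mulr_ge0//; have := C1; lra.
by move=> /le_trans /(_ h); rewrite ler_pM2l.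
Qed.

(** A doubling condition, obtained from [gauge_mul] with second argument [1 / 2]. *)
Lemma gauge_half x : 0 <= x <= 1 -> g x <= C / g 2^-1 * g (x / 2).
Proof.
move=> x01; have g2 : 0 < g 2^-1 by apply: (gauge_gt0 gC); lra.
have := @gauge_mul _ _ _ gC x 2^-1 x01 ltac:(lra).
by rewrite -ler_pdivlMr// mulrAC.
Qed.

Let K := C / g 2^-1.

Let K_gt0 : 0 < K.
Proof. by rewrite divr_gt0//; [have := C1; lra|apply: (gauge_gt0 gC); lra]. Qed.

(** One of [x] and [y] is at least [z / 2], so doubling and essential monotonicity suffice. *)
Lemma gauge_triangle : exists2 D, 1 <= D & forall x y z,
  0 <= x <= 1 -> 0 <= y <= 1 -> 0 <= z <= 1 -> z <= x + y ->
  g z <= D * (g x + g y).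
Proof.
have half m z : 0 <= m <= 1 -> 0 <= z <= 1 -> z / 2 <= m -> g z <= K * C * g m.
  move=> m01 z01 zm; apply: le_trans (gauge_half z01) _.
  by rewrite -[leRHS]mulrA -/K ler_pM2l//; apply: gauge_incr => //; lra.
exists (Num.max 1 (K * C)); first by rewrite le_max lexx.
move=> x y z x01 y01 z01 zxy.
have gx := gauge_ge0 x01; have gy := gauge_ge0 y01.
apply: (@le_trans _ _ (K * C * (g x + g y))); last first.
  by rewrite ler_wpM2r ?addr_ge0// le_max lexx orbT.
have KC : 0 <= K * C by rewrite mulr_ge0 ?ltW//; have := C1; lra.
have [le|le] : z / 2 <= x \/ z / 2 <= y by have [|] := leP (z / 2) x; [left|right; lra].
  by apply: le_trans (half _ _ x01 z01 le) _; rewrite ler_wpM2l// lerDl.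
by apply: le_trans (half _ _ y01 z01 le) _; rewrite ler_wpM2l// lerDr.
Qed.

(* A substitute for Jensen's inequality: with [w = s / N], the slope condition
   gives [(y i - w / 2) * g (w / 2) <= C * (w / 2) * g (y i)] for every [i],
   and these are summed. *)
Lemma gauge_chain : exists2 D, 0 < D & forall (N : nat) (y : nat -> R) (s : R),
  (0 < N)%N -> (forall i, 0 <= y i <= 1) -> 0 <= s <= 1 ->
  s <= \sum_(0 <= i < N) y i ->
  N%:R * (g s * g N%:R^-1) <= D * \sum_(0 <= i < N) g (y i).
Proof.
have C0 : 0 < C by have := C1; lra.
exists (C * K * C); first exact: mulr_gt0 (mulr_gt0 C0 K_gt0) C0.
move=> N y s N0 y01 s01 sy.
have N0R : 0 < N%:R :> R by rewrite ltr0n.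
have N1R : 1 <= N%:R :> R by rewrite ler1n.
have Ninv : 0 < N%:R^-1 :> R by rewrite invr_gt0.
have Ninv1 : N%:R^-1 <= 1 :> R by rewrite invf_le1.
have sum0 : 0 <= \sum_(0 <= i < N) g (y i) by apply: sumr_ge0 => i _; exact: gauge_ge0.
have [s0|sn0] := ltP 0 s; last first.
  have -> : s = 0 by lra.
  by rewrite (gauge0 gC) mul0r mulr0 mulr_ge0// (ltW (mulr_gt0 (mulr_gt0 C0 K_gt0) C0)).
set w := s / N%:R.
have w0 : 0 < w by rewrite divr_gt0.
have w1 : w <= 1 by rewrite ler_pdivrMr//; lra.
have step i : (y i - w / 2) * g (w / 2) <= C * (w / 2) * g (y i).
  have gi := gauge_ge0 (y01 i).
  have gw : 0 <= g (w / 2) by apply: gauge_ge0; lra.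
  have [le|lt] := leP (w / 2) (y i).
    have := @gauge_slope _ _ _ gC (w / 2) (y i) ltac:(lra) le ltac:(by case/andP: (y01 i)).
    by rewrite -(mulrA C); apply: le_trans; rewrite ler_wpM2r//; lra.
  apply: (@le_trans _ _ 0).
    by rewrite mulr_le0_ge0//; lra.
  by rewrite !mulr_ge0//; have := C1; lra.
have sum : N%:R * (w / 2) * g (w / 2) <= (w / 2) * (C * \sum_(0 <= i < N) g (y i)).
  have le : \sum_(0 <= i < N) ((y i - w / 2) * g (w / 2)) <=
            \sum_(0 <= i < N) (C * (w / 2) * g (y i)) by apply: ler_sum_nat.
  rewrite -mulr_suml sumrB -mulr_sumr in le.
  rewrite sumr_const_nat subn0 -(mulr_natl (w / 2)) in le.
  apply: le_trans (_ : _ <= C * (w / 2) * \sum_(0 <= i < N) g (y i)) _; last first.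
    by rewrite (mulrC C) mulrA.
    apply: le_trans le; rewrite ler_wpM2r//; first by apply: gauge_ge0; lra.
  have : N%:R * w = s by rewrite mulrC divfK// gt_eqF.
  lra.
have gwle : N%:R * g (w / 2) <= C * \sum_(0 <= i < N) g (y i).
  by move: sum; rewrite mulrAC mulrC ler_pM2l//; lra.
(* Multiplicativity replaces the product by [g (s / N)], and one halving brings the argument down to
   [w / 2]. *)
have m1 : g s * g N%:R^-1 <= C * g w by apply: (gauge_mul gC) => //; rewrite Ninv1 ltW.
have m2 : g w <= K * g (w / 2) by apply: gauge_half; lra.
apply: (@le_trans _ _ (N%:R * (C * (K * g (w / 2))))).
  rewrite ler_pM2l//; apply: le_trans m1 _.
  by rewrite ler_pM2l//; have := C1; lra.
have -> : N%:R * (C * (K * g (w / 2))) = C * K * (N%:R * g (w / 2)) by ring.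
by rewrite -(mulrA (C * K)) ler_pM2l// mulr_gt0//; have := C1; lra.
Qed.

End GaugeTheory.

(** * Series with bounded partial sums *)

Definition bounded_series (R : realType) (a : nat -> R) : Prop :=
  exists M, forall n, \sum_(0 <= i < n) a i <= M.

Section BoundedSeries.
Variable R : realType.
Implicit Types a c : nat -> R.

Lemma nneseries_ltyP a : (forall n, 0 <= a n) ->
  (\sum_(0 <= n <oo) (a n)%:E < +oo)%E <-> bounded_series a.
Proof.
move=> a0; split => [lt|[M aM]].
  have fin : (\sum_(0 <= n <oo) (a n)%:E)%E \is a fin_num.
    by rewrite ge0_fin_numE//; apply: nneseries_ge0 => n _ _; rewrite lee_fin.
  exists (fine (\sum_(0 <= n <oo) (a n)%:E)%E) => n.
  rewrite -lee_fin fineK// -sumEFin; apply: nneseries_lim_ge => i _.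
  by rewrite lee_fin.
apply: (@le_lt_trans _ _ M%:E); last by rewrite ltry.
apply: lime_le; first by apply: is_cvg_nneseries => n _ _; rewrite lee_fin.
by near=> n; rewrite sumEFin lee_fin.
Unshelve. all: by end_near. Qed.

Lemma le_bounded_series a c k : (forall n, a n <= k * c n) -> 0 <= k ->
  bounded_series c -> bounded_series a.
Proof.
move=> ac k0 [M cM]; exists (k * M) => n.
apply: (@le_trans _ _ (k * \sum_(0 <= i < n) c i)); last by rewrite ler_wpM2l.
by rewrite mulr_sumr; apply: ler_sum_nat.
Qed.

Lemma bounded_seriesD a c : bounded_series a -> bounded_series c ->
  bounded_series (fun n => a n + c n).
Proof.
move=> [M aM] [N cN]; exists (M + N) => n.
by rewrite big_split/= lerD.
Qed.

End BoundedSeries.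

(** * The cube of sequences in the unit interval *)

Section UnitCube.
Variable R : realType.
Implicit Types x y : unit_cube R.

Definition cube_coord (n : nat) (x : unit_cube R) : R := set_val (x n).

Lemma cube_coord01 n x : 0 <= cube_coord n x <= 1.
Proof. by have := set_valP (x n); rewrite /= in_itv. Qed.

Lemma cube_dist01 x y n : 0 <= `|cube_coord n y - cube_coord n x| <= 1.
Proof.
rewrite normr_ge0 ler_norml; have := cube_coord01 n x; have := cube_coord01 n y.
lra.
Qed.

Lemma itv01_0 : `[0 : R, 1]%classic 0.
Proof. by apply/itv01P; rewrite lexx ler01. Qed.

(** Total on [R], so that any real sequence yields a point of the cube; [0] is the default outside
    the interval. *)
Definition to_unit_interval (r : R) : set_type `[0 : R, 1] :=
  if pselect (`[0 : R, 1]%classic r) is left h then exist _ r (mem_set h)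
  else exist _ 0 (mem_set itv01_0).

Lemma to_unit_intervalK r : 0 <= r <= 1 -> set_val (to_unit_interval r) = r.
Proof.
rewrite /to_unit_interval => r01; case: pselect => [//|[]].
exact/itv01P.
Qed.

Definition cube_point (r : nat -> R) : unit_cube R := fun n => to_unit_interval (r n).

Lemma cube_pointK r n : 0 <= r n <= 1 -> cube_coord n (cube_point r) = r n.
Proof. exact: to_unit_intervalK. Qed.

Lemma cube_coord_continuous n : continuous (cube_coord n).
Proof.
move=> x; apply: (@continuous_comp _ _ _ (fun x : unit_cube R => x n) set_val).
  exact: (@proj_continuous _ (fun=> set_type `[0 : R, 1]) n).
exact: initial_continuous.
Qed.

Lemma cube_continuous (X : topologicalType) (theta : X -> unit_cube R) :
  (forall n, continuous (fun t => cube_coord n (theta t))) -> continuous theta.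
Proof.
move=> ct t; apply/pointwise_cvgP => n.
have := @continuous_comp_initial _ X _ set_val (fun t => theta t n) (ct n).
exact.
Qed.

(** Otherwise points outside [B] that agree with [x] on longer and longer initial segments would
    converge to [x] coordinatewise, against openness. *)
Lemma cube_cylinder (B : set (unit_cube R)) x : open B -> B x ->
  exists n, forall y, (forall i, (i < n)%N -> y i = x i) -> B y.
Proof.
move=> oB Bx; apply: contrapT => none.
have /choice[y yP] : forall n, exists y,
    (forall i, (i < n)%N -> y i = x i) /\ ~ B y.
  move=> n; apply: contrapT => h; apply: none; exists n => y yx.
  by apply: contrapT => nB; apply: h; exists y.
have cv : (y : nat -> unit_cube R) @ \oo --> x.
  apply/pointwise_cvgP => i; apply: (@cvg_near_cst).
  by rewrite near_map; near=> n; apply: (yP n).1; near: n; exact: nbhs_infty_gt.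
have /cv [N _ NP] : nbhs x B by exact: open_nbhs_nbhs.
exact: (yP N).2 (NP N (leqnn N)).
Unshelve. all: by end_near. Qed.

Lemma continuous_Borel_map (X Y : topologicalType) (theta : X -> Y) :
  continuous theta -> Borel_map theta.
Proof.
move=> /continuousP ct; rewrite /Borel_map.
apply: smallest_sub => /=.
  split=> [|A mA|A mA].
  - by rewrite preimage_set0; exact: sigma_algebra0.
  - by rewrite setTD preimage_setC -setTD; exact: sigma_algebraCD.
  - by rewrite preimage_bigcup; exact: sigma_algebra_bigcup.
by move=> A oA; apply: sub_sigma_algebra; exact: ct.
Qed.

Lemma E_relP (C : R) f x y : gauge C f -> E_rel f x y <->
  bounded_series (fun n => f `|cube_coord n y - cube_coord n x|).
Proof.
move=> gf; apply: nneseries_ltyP => n.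
exact: gauge_ge0 gf _ (cube_dist01 x y n).
Qed.

Lemma E_rel_equivalence (C : R) f : gauge C f -> equivalence (unit_cube R) (E_rel f).
Proof.
move=> gf; split.
- move=> x; apply/(E_relP _ _ gf); exists 0 => n.
  by rewrite big1// => i _; rewrite subrr normr0 (gauge0 gf).
- move=> x y z /(E_relP _ _ gf) xy /(E_relP _ _ gf) yz; apply/(E_relP _ _ gf).
  have [D D1 tri] := gauge_triangle gf.
  apply: le_bounded_series (bounded_seriesD xy yz); last exact: le_trans D1.
  move=> n; apply: tri; [exact: cube_dist01|exact: cube_dist01|exact: cube_dist01|].
  by rewrite [leRHS]addrC; apply: le_trans (ler_normD _ _); rewrite addrA subrK.
- move=> x y /(E_relP _ _ gf) h; apply/(E_relP _ _ gf).
  by apply: le_bounded_series h => // n; rewrite mul1r distrC.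
Qed.

(** A nonnegative double series may be summed along [e] or row by row, and row [n] is comparable
    with [c n]. *)
Lemma bounded_pair_series (e : nat -> nat * nat) (a : nat * nat -> R)
    (c : nat -> R) (k1 k2 : R) :
  set_bij setT setT e -> (forall p, 0 <= a p) -> 0 < k1 -> 0 < k2 ->
  (forall n m, \sum_(0 <= i < m) a (n, i) <= k2 * c n) ->
  (forall n, exists m, k1 * c n <= \sum_(0 <= i < m) a (n, i)) ->
  bounded_series (fun j => a (e j)) <-> bounded_series c.
Proof.
move=> be a0 k10 k20 up lo.
have c0 n : 0 <= c n by have := up n 0%N; rewrite big_geq// pmulr_rge0.
have sumE : (\sum_(0 <= j <oo) (a (e j))%:E =
    \sum_(0 <= n <oo) \sum_(0 <= m <oo) (a (n, m))%:E)%E.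
  rewrite nneseries_esumT; last by move=> j; rewrite lee_fin.
  rewrite -(@reindex_esum _ _ _ _ _ _ (fun p => (a p)%:E) be).
  rewrite nneseries_esumT; last first.
    by move=> n; apply: nneseries_ge0 => m _ _; rewrite lee_fin.
  rewrite (eq_esum (b := fun n => \esum_(m in setT) (a (n, m))%:E)%E); last first.
    by move=> n _; rewrite nneseries_esumT// => m; rewrite lee_fin.
  rewrite esum_esum; last by move=> n m _ _; rewrite lee_fin.
  congr (esum _ _); first by apply/seteqP; split.
  by apply/funext => -[].
have inner n : (\sum_(0 <= m <oo) (a (n, m))%:E <= (k2 * c n)%:E)%E.
  apply: lime_le; first by apply: is_cvg_nneseries => m _ _; rewrite lee_fin.
  by apply: nearW => m; rewrite sumEFin lee_fin.
have inner' n : ((k1 * c n)%:E <= \sum_(0 <= m <oo) (a (n, m))%:E)%E.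
  have [m mP] := lo n; apply: (@le_trans _ _ (\sum_(0 <= i < m) a (n, i))%:E).
    by rewrite lee_fin.
  by rewrite -sumEFin; apply: nneseries_lim_ge => i _; rewrite lee_fin.
have scaled k : 0 < k -> bounded_series (fun n => k * c n) <-> bounded_series c.
  move=> k0; split; last by apply: le_bounded_series => //; exact: ltW.
  apply: (@le_bounded_series _ _ _ k^-1); last by rewrite invr_ge0 ltW.
  by move=> n; rewrite mulrA mulVf ?mul1r// gt_eqF.
rewrite -nneseries_ltyP//.
rewrite sumE; split => h.
  apply/(scaled k1) => //; apply/nneseries_ltyP.
    by move=> n; rewrite mulr_ge0// ltW.
  apply: le_lt_trans h; apply: lee_nneseries => [n _ _|n _]; last exact: inner'.
  by rewrite lee_fin mulr_ge0// ltW.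
move/(scaled k2) : h => /(_ k20) /nneseries_ltyP h.
apply: le_lt_trans (h _); last by move=> n; rewrite mulr_ge0// ltW.
apply: lee_nneseries => [n _ _|n _]; last exact: inner.
by apply: nneseries_ge0 => m _ _; rewrite lee_fin.
Qed.

End UnitCube.

Lemma nat_pair_bij : exists e : nat -> nat * nat, set_bij setT setT e.
Proof.
have /card_esym/pcard_eqP[f] := card_nat2.
by exists f; exact: bij.
Qed.

(** * Zigzag embeddings *)

Section Dyadic.
Variable R : realType.

Lemma dyadic01 n : 0 < (2 ^- n : R) <= 1.
Proof. by rewrite invr_gt0 exprn_gt0//= invf_le1 ?exprn_gt0// exprn_ege1// ler1n. Qed.

Lemma dyadicS n : 2 ^- n.+1 = 2 ^- n / 2 :> R.
Proof. by rewrite exprS invfM mulrC. Qed.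

Lemma dyadic_mono m n : (m <= n)%N -> 2 ^- n <= 2 ^- m :> R.
Proof.
move=> mn; rewrite lef_pV2 ?posrE ?exprn_gt0//.
by rewrite ler_eXn2l// ltr1n.
Qed.

Lemma dyadic_archi (x : R) : 0 < x -> exists n, 2 ^- n < x.
Proof.
move=> x0; exists (Num.bound x^-1).
rewrite invf_plt ?posrE ?exprn_gt0//.
apply: lt_trans (archi_boundP _) _; first by rewrite invr_ge0 ltW.
by rewrite -natrX ltr_nat ltn_expl.
Qed.

Lemma dyadic_scale (x : R) : 0 < x -> x <= 1 -> exists n, 2 ^- n.+1 < x <= 2 ^- n.
Proof.
move=> x0 x1; have ex := dyadic_archi x0.
case: (ex_minnP ex) => -[|n] nx nmin.
  by rewrite expr0 invr1 ltNge x1 in nx.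
exists n; rewrite nx leNgt; apply/negP => /nmin.
by rewrite ltnn.
Qed.

(** Two halvings. The factor 4 absorbs the dyadic rounding of a distance together with a shift by
    one scale. *)
Lemma gauge_quarter (C : R) (g : R -> R) : gauge C g -> exists2 D, 0 < D &
  forall u d, 0 <= u <= 1 -> 0 <= d <= 1 -> u / 4 <= d -> g u <= D * g d.
Proof.
move=> gC; have [D D1 tri] := gauge_triangle gC; have C1 := gauge_ge1 gC.
exists (D * 2 * (D * 2) * C); first by rewrite !mulr_gt0//; lra.
move=> u d u01 d01 ud.
have h v : 0 <= v <= 1 -> g v <= D * 2 * g (v / 2).
  move=> v01; have := tri (v / 2) (v / 2) v ltac:(lra) ltac:(lra) v01 ltac:(lra).
  lra.
apply: le_trans (h _ u01) _; rewrite -!mulrA !ler_pM2l//; try lra.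
apply: le_trans (h _ _) _; first lra.
rewrite -!mulrA !ler_pM2l//; try lra.
by apply: (gauge_incr gC); lra.
Qed.

End Dyadic.

Section Zigzag.
Variable R : realType.
Implicit Types s t : R.

(** The distance to the nearest even integer, a triangle wave of period 2 with slopes [1] and
    [-1]. *)
Definition zigzag t : R := `|t - 2 * (Num.floor ((t + 1) / 2))%:~R|.

Let zigzag_bounds t : -1 <= t - 2 * (Num.floor ((t + 1) / 2))%:~R < 1.
Proof.
have := floor_le ((t + 1) / 2); have := floorD1_gt ((t + 1) / 2).
by rewrite intrD; lra.
Qed.

Lemma zigzag01 t : 0 <= zigzag t <= 1.
Proof. by rewrite /zigzag normr_ge0 ler_norml; have := zigzag_bounds t; lra. Qed.

Lemma zigzag_le t (k : int) : zigzag t <= `|t - 2 * k%:~R|.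
Proof.
have := zigzag_bounds t; rewrite /zigzag; set m := Num.floor _ => mt.
have [km|mk|->//] := ltgtP k m.
  have : k%:~R + 1 <= m%:~R :> R by rewrite -(intrD _ k 1) ler_int lezD1.
  move=> h; apply: le_trans (_ : _ <= t - 2 * k%:~R) (ler_norm _).
  by rewrite ler_norml; lra.
have : m%:~R + 1 <= k%:~R :> R by rewrite -(intrD _ m 1) ler_int lezD1.
move=> h; rewrite distrC -normrN; apply: le_trans (_ : _ <= - (t - 2 * k%:~R)) _.
  by rewrite ler_norml; lra.
by rewrite -[in leRHS]normrN; exact: ler_norm.
Qed.

Lemma zigzag_lipschitz s t : `|zigzag s - zigzag t| <= `|s - t|.
Proof.
have half a b : zigzag a - zigzag b <= `|a - b|.
  rewrite lerBlDr; apply: le_trans (zigzag_le a (Num.floor ((b + 1) / 2))) _.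
  by rewrite /zigzag; apply: le_trans (ler_normD _ _); rewrite addrA subrK.
by rewrite ler_norml half andbT lerNl opprB distrC half.
Qed.

Lemma zigzag_near t (k : int) : `|t - 2 * k%:~R| <= 1 -> zigzag t = `|t - 2 * k%:~R|.
Proof.
rewrite ler_norml => tk; apply/eqP; rewrite eq_le zigzag_le/=.
have := zigzag_bounds t; rewrite /zigzag; set m := Num.floor _ => mt.
have [km|mk|->//] := ltgtP k m.
  have h : k%:~R + 1 <= m%:~R :> R by rewrite -(intrD _ k 1) ler_int lezD1.
  apply: le_trans (_ : _ <= - (t - 2 * m%:~R)) _; last by rewrite -normrN ler_norm.
  by rewrite ler_norml; lra.
have h : m%:~R + 1 <= k%:~R :> R by rewrite -(intrD _ m 1) ler_int lezD1.
lra.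
Qed.

Lemma zigzag_slope (m : int) s t : m%:~R <= s <= m%:~R + 1 -> m%:~R <= t <= m%:~R + 1 ->
  `|zigzag s - zigzag t| = `|s - t|.
Proof.
have [k [mE|mE]] : exists k : int, m = 2 * k \/ m = 2 * k + 1.
  exists (m %/ 2)%Z; have := divz_eq m 2; have := modz_ge0 m (isT : 2 != 0 :> int).
  by have := @ltz_pmod m 2 isT; lia.
  rewrite mE intrM => sm tm.
  have val r : 2 * k%:~R <= r <= 2 * k%:~R + 1 -> zigzag r = r - 2 * k%:~R.
    by move=> rk; rewrite (@zigzag_near _ k) ?ler_norml ?ger0_norm; lra.
  by rewrite !val//; congr `|_|; ring.
rewrite mE intrD intrM => sm tm.
have val r : 2 * k%:~R + 1 <= r <= 2 * k%:~R + 1 + 1 ->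
    zigzag r = 2 * k%:~R + 2 - r.
  move=> rk; rewrite (@zigzag_near _ (k + 1)) ?ler_norml ?intrD; last lra.
  by rewrite ler0_norm; lra.
by rewrite !val// -normrN; congr `|_|; ring.
Qed.

(** The wave turns only at integers. An interval of length at most [1 / 2] with an integer in its
    interior has none there after a shift by [1 / 2], so one of the two phases is isometric on
    it. *)
Lemma zigzag_phase s t : `|s - t| <= 2^-1 ->
  `|zigzag s - zigzag t| = `|s - t| \/
  `|zigzag (s + 2^-1) - zigzag (t + 2^-1)| = `|s - t|.
Proof.
wlog st : s t / s <= t.
  move=> W; have [/W//|/ltW/W] := leP s t.
  by rewrite distrC (distrC (zigzag _)) (distrC (zigzag (_ + _))).
rewrite ler_norml => d.
have := floor_le s; have := floorD1_gt s; rewrite intrD; set m := Num.floor s => s1 s0.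
have [le|lt] := leP t (m%:~R + 1).
  by left; apply: (@zigzag_slope m); lra.
right; rewrite (@zigzag_slope (m + 1)) ?intrD; [|lra|lra].
by congr `|_|; ring.
Qed.

End Zigzag.

(** * Reduction by zigzag copies at all scales *)

Section ScaleReduction.
Variables (R : realType) (Cf Cg : R) (f g : R -> R) (M : nat -> nat) (k1 k2 : R).
Hypotheses (gf : gauge Cf f) (gg : gauge Cg g).
Hypotheses (M_homo : {homo M : m n / (m <= n)%N}) (M_gt0 : (0 < M 0)%N).
Hypotheses (k1_gt0 : 0 < k1) (k2_gt0 : 0 < k2).
Hypothesis M_lower : forall n, k1 * f (2 ^- n) <= (M n)%:R * g (2 ^- n).
Hypothesis M_upper : forall n, (M n)%:R * g (2 ^- n) <= k2 * f (2 ^- n).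
Implicit Types x y : R.

(* The coordinates [c] with [2 * M i.-1 <= c < 2 * M i] live at scale [2 ^- i];
   even and odd [c] differ by half a phase. *)
Definition zigzag_coord (c : nat) x : R :=
  if pselect (exists i, (c < 2 * M i)%N) is left h then
    2 ^- ex_minn h * zigzag (2 ^+ ex_minn h * x + (odd c)%:R / 2)
  else 0.

Lemma zigzag_coordP c :
  (exists i, [/\ (c < 2 * M i)%N, forall j, (c < 2 * M j)%N -> (i <= j)%N &
    forall x, zigzag_coord c x = 2 ^- i * zigzag (2 ^+ i * x + (odd c)%:R / 2)]) \/
  (forall i, (2 * M i <= c)%N) /\ forall x, zigzag_coord c x = 0.
Proof.
rewrite /zigzag_coord; case: pselect => [h|h].
  by left; case: (ex_minnP h) => i ci imin; exists i.
by right; split=> // i; rewrite leqNgt; apply/negP => ci; apply: h; exists i.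
Qed.

Lemma zigzag_coord01 c x : 0 <= zigzag_coord c x <= 1.
Proof.
have [[i [_ _ ->]]|[_ ->]] := zigzag_coordP c; last by rewrite lexx ler01.
have /andP[z0 z1] := zigzag01 (2 ^+ i * x + (odd c)%:R / 2).
have /andP[d0 d1] := dyadic01 R i.
by rewrite mulr_ge0 ?(ltW d0)//= mulr_ile1// ltW.
Qed.

Lemma zigzag_coord_lipschitz c x y :
  `|zigzag_coord c x - zigzag_coord c y| <= `|x - y|.
Proof.
have [[i [_ _ zE]]|[_ zE]] := zigzag_coordP c; rewrite !zE; last by rewrite subrr normr0.
have /andP[d0 _] := dyadic01 R i.
rewrite -mulrBr normrM gtr0_norm// mulrC ler_pdivrMr ?exprn_gt0//.
apply: le_trans (zigzag_lipschitz _ _) _.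
rewrite opprD addrACA subrr addr0 -mulrBr normrM gtr0_norm ?exprn_gt0//.
by rewrite mulrC.
Qed.

(** Such a coordinate vanishes or lives at a scale beyond [n], where its amplitude bounds the
    difference. *)
Lemma zigzag_coord_small c n x y : (2 * M n <= c)%N ->
  `|zigzag_coord c x - zigzag_coord c y| <= 2 ^- n.+1.
Proof.
have [[i [ci imin zE]]|[_ zE]] := zigzag_coordP c => nc; rewrite !zE; last first.
  by rewrite subrr normr0; have /andP[/ltW] := dyadic01 R n.+1.
have /andP[d0 _] := dyadic01 R i.
apply: (@le_trans _ _ (2 ^- i)); last first.
  apply: dyadic_mono; rewrite ltnNge; apply/negP => ni.
  by have := leq_trans ci (leq_trans (leq_mul (leqnn 2) (M_homo ni)) nc); rewrite ltnn.
rewrite -mulrBr normrM gtr0_norm// ger_pMr// ler_norml.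
have := zigzag01 (2 ^+ i * x + (odd c)%:R / 2).
have := zigzag01 (2 ^+ i * y + (odd c)%:R / 2).
lra.
Qed.

Lemma zigzag_coord_continuous c : continuous (zigzag_coord c).
Proof.
move=> x; apply/cvgrPdist_lt => e e0; near=> y.
apply: le_lt_trans (zigzag_coord_lipschitz c x y) _.
by near: y; exact: (nbhsx_ballx x e e0).
Unshelve. all: by end_near. Qed.

Let a x y c := g `|zigzag_coord c x - zigzag_coord c y|.

Let dist01 c x y : 0 <= `|zigzag_coord c x - zigzag_coord c y| <= 1.
Proof.
rewrite normr_ge0 ler_norml; have := zigzag_coord01 c x.
have := zigzag_coord01 c y; lra.
Qed.

Let a_ge0 x y c : 0 <= a x y c.
Proof. exact: gauge_ge0 gg _ (dist01 _ _ _). Qed.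

Let Cg1 : 1 <= Cg := gauge_ge1 gg.

Let sum_coarse x y n : `|x - y| <= 2 ^- n ->
  \sum_(0 <= c < 2 * M n) a x y c <= 2 * Cg * k2 * f (2 ^- n).
Proof.
move=> xyn; have /andP[d0 d1] := dyadic01 R n; have C1 := Cg1.
apply: (@le_trans _ _ (\sum_(0 <= c < 2 * M n) (Cg * g (2 ^- n)))).
  apply: ler_sum_nat => c _; apply: (gauge_incr gg) => //.
  exact: le_trans (zigzag_coord_lipschitz _ _ _) xyn.
rewrite sumr_const_nat subn0 -[leLHS]mulr_natl natrM.
have -> : 2 * (M n)%:R * (Cg * g (2 ^- n)) = 2 * Cg * ((M n)%:R * g (2 ^- n)) by ring.
by rewrite -(mulrA _ k2) ler_pM2l//; lra.
Qed.

(** Here the amplitude is the bound: the block of scale [i] contributes at most a multiple of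
    [f (2 ^- i)], and the slope condition on [f] makes these terms decay geometrically. The factor
    [1 - 2 ^- N] carries the geometric sum through the induction. *)
Let sum_fine x y n N :
  \sum_(2 * M n <= c < 2 * M (n + N)) a x y c <=
  2 * Cg * k2 * Cf * f (2 ^- n) * (1 - 2 ^- N).
Proof.
have C1 := Cg1; have Cf1 := gauge_ge1 gf.
elim: N => [|N IH]; first by rewrite addn0 big_geq// expr0 invr1 subrr mulr0.
have le1 : (2 * M n <= 2 * M (n + N))%N by rewrite leq_mul2l M_homo// leq_addr.
have le2 : (2 * M (n + N) <= 2 * M (n + N.+1))%N.
  by rewrite leq_mul2l M_homo// leq_add2l.
rewrite (@big_cat_nat _ _ _ (2 * M (n + N)))//=.
set i := (n + N.+1)%N in le2 *; have /andP[d0 d1] := dyadic01 R i.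
have fi : 0 <= f (2 ^- i) by apply: (gauge_ge0 gf); rewrite ltW.
have blk : \sum_(2 * M (n + N) <= c < 2 * M i) a x y c <= 2 * Cg * k2 * f (2 ^- i).
  apply: (@le_trans _ _ (\sum_(2 * M (n + N) <= c < 2 * M i) (Cg * g (2 ^- i)))).
    apply: ler_sum_nat => c /andP[ci _]; apply: (gauge_incr gg) => //.
    by rewrite /i addnS; exact: zigzag_coord_small.
  rewrite sumr_const_nat -[leLHS]mulr_natl.
  have gi : 0 <= g (2 ^- i) by apply: (gauge_ge0 gg); rewrite ltW.
  apply: (@le_trans _ _ ((2 * M i)%:R * (Cg * g (2 ^- i)))).
    by rewrite ler_wpM2r ?ler_nat ?leq_subr// mulr_ge0//; lra.
  rewrite natrM.
  have -> : 2 * (M i)%:R * (Cg * g (2 ^- i)) = 2 * Cg * ((M i)%:R * g (2 ^- i)) by ring.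
  by rewrite -(mulrA _ k2) ler_pM2l//; lra.
have slope : f (2 ^- i) <= Cf * (2 ^- N.+1 * f (2 ^- n)).
  have /andP[n0 n1] := dyadic01 R n.
  have := gauge_slope gf (ltW d0) (dyadic_mono R (leq_addr N.+1 n)) n1.
  by rewrite /i exprD invfM -mulrA (mulrCA Cf) ler_pM2l.
have k0 : 0 <= 2 * Cg * k2 by rewrite mulr_ge0 ?ltW//; lra.
have := ler_wpM2l k0 slope; rewrite dyadicS => slope'.
set t := 2 ^- N in IH slope' *.
have -> : 2 * Cg * k2 * Cf * f (2 ^- n) * (1 - t / 2) =
  2 * Cg * k2 * Cf * f (2 ^- n) * (1 - t) + 2 * Cg * k2 * (Cf * (t / 2 * f (2 ^- n))).
  by field.
by apply: lerD IH _; exact: le_trans blk slope'.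
Qed.

Lemma zigzag_sum_upper : exists2 D, 0 < D & forall x y m,
  0 <= `|x - y| <= 1 -> \sum_(0 <= c < m) a x y c <= D * f `|x - y|.
Proof.
have C1 := Cg1; have Cf1 := gauge_ge1 gf.
have [Q Q0 quarter] := gauge_quarter gf.
have B0 : 0 < 2 * Cg * k2 * (1 + Cf) by rewrite !mulr_gt0//; lra.
exists (2 * Cg * k2 * (1 + Cf) * Q); first by rewrite mulr_gt0.
move=> x y m xy01; have [d0|dn0] := ltP 0 `|x - y|; last first.
  have xy : `|x - y| = 0 by lra.
  rewrite big1 ?xy ?(gauge0 gf) ?mulr0// => c _; rewrite /a.
  have := zigzag_coord_lipschitz c x y; rewrite xy normr_le0 => /eqP->.
  by rewrite normr0 (gauge0 gg).
have [n /andP[nd dn]] := dyadic_scale d0 (andP xy01).2.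
have /andP[n0 n1] := dyadic01 R n; rewrite dyadicS in nd.
have fn : f (2 ^- n) <= Q * f `|x - y| by apply: quarter; lra.
have fn0 : 0 <= f (2 ^- n) by apply: (gauge_ge0 gf); rewrite ltW.
rewrite -[leRHS]mulrA; apply: le_trans (ler_wpM2l (ltW B0) fn).
(* [N] is so large that every coordinate below [m] has scale at most [N] or contributes [0]. *)
have [N nN NP] := @finite_upper_bound _ (iota 0 m)
  (fun c N => (c < 2 * M N)%N \/ a x y c = 0) n
  ltac:(by move=> c p q pq [lt|]; [left; apply: leq_trans lt _; rewrite leq_mul2l M_homo|right])
  ltac:(by move=> c _; have [[i [ci _ _]]|[_ zE]] := zigzag_coordP c;
    [exists i; left|exists 0%N; right; rewrite /a !zE subrr normr0 (gauge0 gg)]).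
apply: (@le_trans _ _ (\sum_(0 <= c < 2 * M N) a x y c)).
  have [le|/ltnW le] := leqP m (2 * M N).
    by rewrite [leRHS](@big_cat_nat _ _ _ m)//= lerDl sumr_ge0.
  rewrite (@big_cat_nat _ _ _ (2 * M N))//= gerDl big_nat big1// => c /andP[cN cm].
  have [|//|->//] := NP c; first by rewrite mem_iota.
  by rewrite ltnNge cN.
rewrite (@big_cat_nat _ _ _ (2 * M n))//= ?leq_mul2l ?M_homo//.
have := sum_coarse dn; have := sum_fine x y n (N - n); rewrite subnKC//.
have /andP[N0 N1] := dyadic01 R (N - n).
have A0 : 0 <= 2 * Cg * k2 * Cf * f (2 ^- n) by rewrite !mulr_ge0// ltW//; lra.
have := ler_wpM2l A0 (_ : 1 - 2 ^- (N - n) <= 1); rewrite mulr1 => /(_ ltac:(lra)).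
lra.
Qed.

(** The bounds [2 * M i] are even, so both coordinates of the pair have the same scale [i <= n], and
    one of the two phases preserves the distance. At scale 0 the unit interval is a single monotone
    piece, which covers [n = 0]. *)
Let pair_lower x y c n : (c < M n)%N -> 0 <= x <= 1 -> 0 <= y <= 1 ->
  n = 0%N \/ 2 ^+ n * `|x - y| <= 2^-1 ->
  g `|x - y| <= a x y (2 * c) + a x y (2 * c).+1.
Proof.
move=> cM x01 y01 nxy.
have [[i [ci imin zE]]|[/(_ n)]] := zigzag_coordP (2 * c); last first.
  by rewrite leq_mul2l/= leqNgt cM.
have [[i' [ci' imin' zE']]|[/(_ n)]] := zigzag_coordP (2 * c).+1; last first.
  by move=> h _; exfalso; lia.
have ii' : i' = i.
  apply/eqP; rewrite eqn_leq imin ?andbT; last by lia.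
  by apply: imin'; lia.
have le_in : (i <= n)%N by apply: imin; lia.
have scale s t : 2 ^- i * s - 2 ^- i * t = 2 ^- i * (s - t) by rewrite mulrBr.
have p0 : 0 < 2 ^+ i :> R by rewrite exprn_gt0.
have full s t : `|zigzag s - zigzag t| = 2 ^+ i * `|x - y| ->
    g `|2 ^- i * zigzag s - 2 ^- i * zigzag t| = g `|x - y|.
  move=> e; rewrite scale normrM e gtr0_norm ?invr_gt0// mulrA mulVf ?mul1r// gt_eqF.
have dE : `|2 ^+ i * x - 2 ^+ i * y| = 2 ^+ i * `|x - y|.
  by rewrite -mulrBr normrM gtr0_norm.
have ae c' : 0 <= a x y c' by exact: a_ge0.
have e1 : odd (2 * c) = false by rewrite oddM.
have e2 : odd (2 * c).+1 = true by rewrite /= oddM.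
have [e|e] : `|zigzag (2 ^+ i * x) - zigzag (2 ^+ i * y)| = 2 ^+ i * `|x - y| \/
    `|zigzag (2 ^+ i * x + 2^-1) - zigzag (2 ^+ i * y + 2^-1)| = 2 ^+ i * `|x - y|.
  have [i0|ipos] := posnP i.
    left; rewrite -dE; apply: (@zigzag_slope _ 0); rewrite i0 expr0 !mul1r; lra.
  rewrite -dE; apply: zigzag_phase; rewrite dE.
  case: nxy => [n0|]; first by rewrite n0 leqn0 gtn_eqF in le_in.
  apply: le_trans; rewrite ler_wpM2r// ler_weXn2l//.
  by rewrite ler1n.
- rewrite {1}/a !zE e1 mul0r !addr0 (full _ _ e).
  by rewrite lerDl.
- rewrite [leRHS]addrC {1}/a !zE' ii' e2 mul1r (full _ _ e).
  by rewrite lerDl.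
Qed.

Lemma zigzag_sum_lower : exists2 D, 0 < D & forall x y,
  0 <= x <= 1 -> 0 <= y <= 1 ->
  exists m, D * f `|x - y| <= \sum_(0 <= c < m) a x y c.
Proof.
have C1 := Cg1; have Cf1 := gauge_ge1 gf.
have [Q Q0 quarter] := gauge_quarter gg.
exists (k1 / (Cf * Q)); first by rewrite divr_gt0// mulr_gt0//; lra.
move=> x y x01 y01; have xy01 : 0 <= `|x - y| <= 1.
  by rewrite normr_ge0 ler_norml; lra.
have [d0|dn0] := ltP 0 `|x - y|; last first.
  exists 0%N; rewrite big_geq//.
  have -> : `|x - y| = 0 by lra.
  by rewrite (gauge0 gf) mulr0.
have [n /andP[nd dn]] := dyadic_scale d0 (andP xy01).2.
(* Scale [n.-1] rather than [n]: the phase argument wants the distance to be at most half of the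
   scale. *)
exists (2 * M n.-1)%N.
have dbl m : \sum_(0 <= c < 2 * m) a x y c =
    \sum_(0 <= c < m) (a x y (2 * c) + a x y (2 * c).+1).
  elim: m => [|m IH]; first by rewrite !big_geq.
  by rewrite mulnS !big_nat_recr//= IH addrA.
have /andP[n0 n1] := dyadic01 R n; have /andP[n'0 n'1] := dyadic01 R n.-1.
have le_d : `|x - y| <= 2 ^- n.-1 by apply: le_trans dn _; apply: dyadic_mono; exact: leq_pred.
have gd : g (2 ^- n.-1) <= Q * g `|x - y|.
  apply: quarter; [lra|lra|]; rewrite dyadicS in nd.
  case: n {dn n0 n1 le_d n'0 n'1} nd => [|n] /=; rewrite ?expr0 ?invr1; first lra.
  rewrite dyadicS; have /andP[? ?] := dyadic01 R n; lra.
rewrite dbl; apply: (@le_trans _ _ (\sum_(0 <= c < M n.-1) g `|x - y|)); last first.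
  apply: ler_sum_nat => c /andP[_ cM]; apply: (@pair_lower _ _ _ n.-1) => //.
  case: n dn {nd le_d n0 n1 n'0 n'1 gd cM} => [|n] dn; [by left|right] => /=.
  rewrite dyadicS in dn; have p0 : 0 < 2 ^+ n :> R by rewrite exprn_gt0.
  by rewrite mulrC -ler_pdivlMr// mulrC.
rewrite sumr_const_nat subn0 -[leRHS]mulr_natl.
have fd : f `|x - y| <= Cf * f (2 ^- n.-1) by apply: (gauge_incr gf).
rewrite mulrAC ler_pdivrMr; last by rewrite mulr_gt0//; lra.
apply: (@le_trans _ _ (Cf * (k1 * f (2 ^- n.-1)))).
  by rewrite mulrCA ler_pM2l.
have -> : (M n.-1)%:R * g `|x - y| * (Cf * Q) = Cf * ((M n.-1)%:R * (Q * g `|x - y|)) by ring.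
rewrite ler_pM2l; last lra.
by apply: le_trans (M_lower _) _; rewrite ler_wpM2l.
Qed.

Lemma scale_reduction : Borel_reducible (E_rel f) (E_rel g).
Proof.
have [e be] := nat_pair_bij.
pose theta (x : unit_cube R) := cube_point (fun j => zigzag_coord (e j).2 (cube_coord (e j).1 x)).
exists theta.
  apply: continuous_Borel_map; apply: cube_continuous => j.
  have -> : (fun t => cube_coord j (theta t)) =
      (fun t => zigzag_coord (e j).2 (cube_coord (e j).1 t)).
    by apply/funext => x; rewrite cube_pointK// zigzag_coord01.
  move=> x; apply: (@continuous_comp _ _ _ (cube_coord (e j).1)).
    exact: cube_coord_continuous.
  exact: zigzag_coord_continuous.
move=> x y; rewrite (E_relP _ _ gf) (E_relP _ _ gg).
have [D1 D10 up] := zigzag_sum_upper; have [D2 D20 lo] := zigzag_sum_lower.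
have := @bounded_pair_series R e
  (fun p => a (cube_coord p.1 y) (cube_coord p.1 x) p.2)
  (fun n => f `|cube_coord n y - cube_coord n x|) _ _ be _ D20 D10.
have -> : (fun j => a (cube_coord (e j).1 y) (cube_coord (e j).1 x) (e j).2) =
    (fun n => g `|cube_coord n (theta y) - cube_coord n (theta x)|).
  by apply/funext => j; rewrite !cube_pointK ?zigzag_coord01.
move=> ->; first by [].
- by move=> p; exact: a_ge0.
- by move=> n m /=; apply: up; exact: cube_dist01.
- by move=> n /=; apply: lo; exact: cube_coord01.
Qed.

End ScaleReduction.

Lemma positive_bounds (R : realType) (r : nat -> R) (n0 : nat) :
  (forall n, 0 < r n) ->
  exists a b, [/\ 0 < a, a <= b & forall n, (n <= n0)%N -> a <= r n <= b].
Proof.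
move=> r0; elim: n0 => [|n0 [a [b [a0 ab abP]]]].
  by exists (r 0%N), (r 0%N); split=> // n; rewrite leqn0 => /eqP->; rewrite lexx.
exists (Num.min a (r n0.+1)), (Num.max b (r n0.+1)); split.
- by rewrite lt_min a0 r0.
- by rewrite ge_min le_max ab.
move=> n; rewrite leq_eqVlt => /orP[/eqP->|/abP/andP[l u]].
  by rewrite ge_min le_max !lexx !orbT.
by rewrite ge_min le_max l u.
Qed.

Lemma reducible_of_increasing_ratio (R : realType) (Cf Cg : R) (f g : R -> R) (n0 : nat) :
  gauge Cf f -> gauge Cg g ->
  (forall n, (n0 <= n)%N ->
    f (2 ^- n) / g (2 ^- n) <= f (2 ^- n.+1) / g (2 ^- n.+1)) ->
  Borel_reducible (E_rel f) (E_rel g).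
Proof.
move=> gf gg ratio; have Cf1 := gauge_ge1 gf; have Cg1 := gauge_ge1 gg.
have fpos n : 0 < f (2 ^- n) by have /andP[? ?] := dyadic01 R n; exact: (gauge_gt0 gf).
have gpos n : 0 < g (2 ^- n) by have /andP[? ?] := dyadic01 R n; exact: (gauge_gt0 gg).
have f1 : 0 < f 1 by have := fpos 0%N; rewrite expr0 invr1.
have g1 : 0 < g 1 by have := gpos 0%N; rewrite expr0 invr1.
(* [W] freezes the ratio before [n0], which makes it nondecreasing; as finitely many values change,
   the cost is the pair of constants [b1], [b2]. *)
pose w n := f (2 ^- n) / g (2 ^- n); pose W n := w (maxn n n0).
have wpos n : 0 < w n by rewrite divr_gt0.
have fE n : f (2 ^- n) = w n * g (2 ^- n) by rewrite divfK// gt_eqF.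
have W_homo : {homo W : m n / (m <= n)%N >-> m <= n}.
  apply: homo_leq => [x|x y z|n]; [exact: lexx|by apply: le_trans|].
  rewrite /W; have [le|lt] := leqP n0 n.
    by rewrite (maxn_idPl (leqW le)); exact: ratio.
  by rewrite (maxn_idPr lt).
have W0 : W 0%N = w n0 by rewrite /W max0n.
have W_ge n : w n0 <= W n by rewrite -W0; exact: W_homo.
pose M n := (Num.truncn (W n)).+1.
have W_ge0 n : 0 <= W n by rewrite /W ltW.
have M_ge n : W n <= (M n)%:R by rewrite ltW// real_truncnS_gt// num_real.
(* Rounding up costs a bounded factor because [W] stays above [w n0]. *)
have M_le n : (M n)%:R <= (1 + (w n0)^-1) * W n.
  rewrite /M -natr1 mulrDl mul1r; apply: lerD.
    by rewrite truncn_le.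
  by rewrite mulrC ler_pdivlMr// mul1r.
have [b1 [b2 [b10 b12 bP]]] := positive_bounds n0 (fun n => divr_gt0 (wpos n) (wpos (maxn n n0))).
have Ww n : Num.min 1 b1 * W n <= w n <= Num.max 1 b2 * W n.
  have Wn : 0 < W n by exact: wpos.
  have [le|lt] := leqP n0 n.
    rewrite /W (maxn_idPl le).
    by rewrite ler_piMl ?ler_peMl ?le_max ?ge_min ?lexx// ltW.
  have /andP[l u] := bP n (ltnW lt).
  rewrite -(ler_pdivlMr _ _ Wn) -(ler_pdivrMr _ _ Wn).
  by rewrite ge_min l orbT le_max u orbT.
have m0 : 0 < Num.min 1 b1 by rewrite lt_min ltr01.
have M0 : 0 < Num.max 1 b2 by rewrite lt_max ltr01.
apply: (@scale_reduction _ Cf Cg f g M (Num.max 1 b2)^-1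
   ((1 + (w n0)^-1) / Num.min 1 b1)) => //.
- by move=> m n /W_homo le; rewrite ltnS le_truncn.
- by rewrite invr_gt0.
- by rewrite divr_gt0// addr_gt0// invr_gt0.
- move=> n; have /andP[_ u] := Ww n.
  rewrite fE mulrA ler_wpM2r ?(ltW (gpos _))//.
  by apply: le_trans (M_ge n); rewrite mulrC ler_pdivrMr// mulrC.
- move=> n; have /andP[l _] := Ww n.
  rewrite fE mulrA ler_wpM2r ?(ltW (gpos _))//.
  apply: le_trans (M_le n) _; rewrite -mulrA ler_pM2l ?addr_gt0 ?invr_gt0//.
  by rewrite mulrC ler_pdivlMr// mulrC.
Qed.

(** * Borel reductions on dyadic grids *)

Section SeriesLemmas.
Variable R : realType.
Implicit Types a : nat -> R.

Lemma bounded_series_dyadic : bounded_series (fun i => 2 ^- i : R).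
Proof.
exists 2 => n; suff -> : \sum_(0 <= i < n) 2 ^- i = 2 - 2 * 2 ^- n :> R.
  by have /andP[? ?] := dyadic01 R n; lra.
elim: n => [|n IH]; first by rewrite big_geq// expr0; lra.
by rewrite big_nat_recr//= IH dyadicS; lra.
Qed.

Lemma bounded_series_finite a n0 : (forall n, (n0 <= n)%N -> a n = 0) ->
  (forall n, 0 <= a n) -> bounded_series a.
Proof.
move=> az a0; exists (\sum_(0 <= i < n0) a i) => n.
have [le|/ltnW le] := leqP n n0.
  by rewrite [leRHS](@big_cat_nat _ _ _ n)//= lerDl sumr_ge0.
rewrite (@big_cat_nat _ _ _ n0)//= gerDl big_nat big1// => i /andP[n0i _].
exact: az.
Qed.

Lemma bounded_series_inj a (b : nat -> nat) : injective b -> (forall n, 0 <= a n) ->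
  (forall n, (forall j, b j != n) -> a n = 0) ->
  bounded_series a <-> bounded_series (a \o b).
Proof.
move=> binj a0 az; rewrite -!nneseries_ltyP//; last by move=> n; exact: a0.
suff -> : (\sum_(0 <= n <oo) (a n)%:E = \sum_(0 <= n <oo) ((a \o b) n)%:E)%E by [].
rewrite !nneseries_esumT; last 2 first.
- by move=> n; rewrite lee_fin a0.
- by move=> n; rewrite lee_fin a0.
rewrite -(@esum_image _ _ _ setT b (fun n => (a n)%:E)); last first.
  by move=> x y _ _; exact: binj.
rewrite [RHS]esum_mkcond; apply: eq_esum => n _.
case: ifPn => //; rewrite notin_setE => nb; rewrite az// => j.
by apply/eqP => bj; apply: nb; exists j.
Qed.

Lemma bounded_series_blocks a (L : nat -> nat) : L 0%N = 0%N ->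
  (forall j, (L j < L j.+1)%N) -> (forall n, 0 <= a n) ->
  bounded_series (fun j => \sum_(L j <= i < L j.+1) a i) <-> bounded_series a.
Proof.
move=> L0 Lm a0.
have tel n : \sum_(0 <= j < n) \sum_(L j <= i < L j.+1) a i = \sum_(0 <= i < L n) a i.
  elim: n => [|n IH]; first by rewrite L0 !big_geq.
  by rewrite big_nat_recr//= IH -big_cat_nat// ltnW.
have Lge n : (n <= L n)%N by elim: n => // n IH; exact: leq_ltn_trans IH (Lm n).
split=> -[B BP]; exists B => n; last by rewrite tel.
apply: le_trans (BP n); rewrite tel [leRHS](@big_cat_nat _ _ _ n)//=.
by rewrite lerDl sumr_ge0.
Qed.

End SeriesLemmas.

Section CloseSequences.
Variables (R : realType) (C : R) (g : R -> R).
Hypothesis gg : gauge C g.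
Implicit Types a b c : nat -> R.

Definition unit_valued a := forall n, 0 <= a n <= 1.

Definition series_close a b := bounded_series (fun n => g `|a n - b n|).

Lemma dist01 a b n : unit_valued a -> unit_valued b -> 0 <= `|a n - b n| <= 1.
Proof. by move=> /(_ n) an /(_ n) bn; rewrite normr_ge0 ler_norml; lra. Qed.

Lemma series_close_sym a b : series_close a b -> series_close b a.
Proof. by move=> [M MP]; exists M => n; under eq_bigr do rewrite distrC. Qed.

Lemma series_close_trans a b c : unit_valued a -> unit_valued b -> unit_valued c ->
  series_close a b -> series_close b c -> series_close a c.
Proof.
move=> ua ub uc ab bc; have [D D1 tri] := gauge_triangle gg.
apply: le_bounded_series (bounded_seriesD ab bc); last exact: le_trans D1.
move=> n; apply: tri; [exact: dist01|exact: dist01|exact: dist01|].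
by apply: le_trans (ler_normD _ _); rewrite addrA subrK.
Qed.

(** The slope condition against the point [1] gives [g (2 ^- n) <= C * 2 ^- n * g 1], which is
    summable. Thus rounding the coordinate [n] to mesh [2 ^- n] does not leave the class. *)
Lemma series_close_dyadic a b : unit_valued a -> unit_valued b ->
  (forall n, `|a n - b n| <= 2 ^- n) -> series_close a b.
Proof.
move=> ua ub ab; have C1 := gauge_ge1 gg.
have g1 : 0 < g 1 by apply: (gauge_gt0 gg).
apply: (@le_bounded_series _ _ _ (C * C * g 1)) (bounded_series_dyadic R).
- move=> n; have /andP[d0 d1] := dyadic01 R n.
  apply: (@le_trans _ _ (C * g (2 ^- n))); first exact: (gauge_incr gg).
  have := gauge_slope gg (ltW d0) d1 (lexx 1); rewrite mul1r => s.
  by rewrite -!mulrA ler_pM2l ?(mulrC (g 1))//; lra.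
- by rewrite !mulr_ge0// ltW//; lra.
Qed.

Lemma E_rel_close (x y : unit_cube R) :
  E_rel g x y <-> series_close (fun n => cube_coord n x) (fun n => cube_coord n y).
Proof.
rewrite (E_relP _ _ gg); split=> -[M MP]; exists M => n; under eq_bigr do rewrite distrC;
  exact: MP.
Qed.

End CloseSequences.

(** Reading naturals through [v] is continuous, and the sets with the Baire property form a
    sigma-algebra containing the open sets. *)
Lemma baire_property_Borel (R : realType) (v : nat -> set_type `[0 : R, 1])
    (B : set (unit_cube R)) : <<s @open (unit_cube R) >> B ->
  baire_property [set x | B (fun n => v (x n))].
Proof.
move: B; apply: smallest_sub => /=.
  have [s0 sC sU] := baire_property_sigma; split=> [|A bA|A bA].
  - exact: s0.
  - by have := sC _ bA; rewrite !setTD.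
  - by have := sU _ bA; congr baire_property; apply/seteqP; split.
move=> B oB; apply: baire_property_open => x Bx.
have [n nB] := cube_cylinder oB Bx; exists n => y /in_cylinder_mkseqP yx.
by apply: nB => i ilt; rewrite yx.
Qed.

Lemma baire_propertyD (A B : set (nat -> nat)) :
  baire_property A -> baire_property B -> baire_property (A `\` B).
Proof.
move=> bA bB; rewrite -[_ `\` _]setCK; apply: baire_propertyC.
suff -> : ~` (A `\` B) = \bigcup_n (fun n => if n is 0%N then ~` A else B) n.
  by apply: baire_property_bigcup => -[|n] //; exact: baire_propertyC.
apply/seteqP; split => x; last first.
  by move=> [[|n] _ /=] h [Ax nBx].
move=> h; have [Bx|nBx] := pselect (B x); first by exists 1%N.
by exists 0%N => //= Ax; exact: h.
Qed.

(** All dyadic points are coded by naturals at once, so that grids of every mesh consist of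
    admissible entries of one generic sequence. *)
Definition dyadic_value (R : realType) (p : nat) : R :=
  if (unpickle p : option (nat * nat)) is Some (i, m) then Num.min 1 (i%:R * 2 ^- m) else 0.

Definition dyadic_code (m i : nat) : nat := pickle (i, m).

Lemma dyadic_value01 (R : realType) p : 0 <= dyadic_value R p <= 1.
Proof.
rewrite /dyadic_value; case: unpickle => [[i m]|]; last by rewrite lexx ler01.
by rewrite ge_min lexx andbT le_min ler01 mulr_ge0// ltW//; case/andP: (dyadic01 R m).
Qed.

Lemma dyadic_codeK (R : realType) m i : (i <= 2 ^ m)%N ->
  dyadic_value R (dyadic_code m i) = i%:R * 2 ^- m.
Proof.
move=> im; rewrite /dyadic_value pickleK; apply: min_r.
by rewrite ler_pdivrMr ?exprn_gt0// mul1r -natrX ler_nat.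
Qed.

(* A Borel reduction agrees, on a product of finite grids of dyadic points, with
   one that acts coordinate by coordinate, coordinate [j] being sent to a block
   of finitely many output coordinates. *)
Lemma modular_reduction (R : realType) (Cf Cg : R) (f g : R -> R) (m : nat -> nat) :
  gauge Cf f -> gauge Cg g -> Borel_reducible (E_rel f) (E_rel g) ->
  exists (L : nat -> nat) (t : nat -> nat -> nat -> R),
    (forall j p, unit_valued (t j p)) /\
    forall p q : nat -> nat, (forall j, (p j <= 2 ^ m j)%N) ->
      (forall j, (q j <= 2 ^ m j)%N) ->
      bounded_series (fun j => f `|(p j)%:R * 2 ^- m j - (q j)%:R * 2 ^- m j|) <->
      bounded_series (fun j =>
        \sum_(L j <= i < L j.+1) g `|t j (p j) i - t j (q j) i|).
Proof.
move=> gf gg [theta Btheta red]; have [D D1 tri] := gauge_triangle gg.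
pose pt (x : nat -> nat) : unit_cube R := cube_point (fun n => dyadic_value R (x n)).
pose c i x := cube_coord i (theta (pt x)).
have c01 i x : 0 <= c i x <= 1 by exact: cube_coord01.
(* Output [i] is rounded down to the grid of mesh [2 ^- i], which makes its range discrete; by
   [c_tt] below the class is unchanged. *)
pose T i x := Num.truncn (2 ^+ i * c i x).
have p0 i : 0 < 2 ^+ i :> R by rewrite exprn_gt0.
have bT i v : baire_property [set x | T i x = v].
  have lt_prop q : baire_property [set x | 2 ^+ i * c i x < q].
    pose B := [set y : unit_cube R | 2 ^+ i * cube_coord i y < q].
    have oB : open B.
      have -> : B = cube_coord i @^-1` [set r | r < q / 2 ^+ i].
        by apply/seteqP; split=> y /=; rewrite /B /= ltr_pdivlMr// mulrC.
      by move/continuousP: (@cube_coord_continuous R i); apply; exact: open_lt.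
    have := @baire_property_Borel R (fun p => to_unit_interval (dyadic_value R p))
      (theta @^-1` B).
    by apply; apply: Btheta; exact: sub_sigma_algebra.
  suff -> : [set x | T i x = v] =
      [set x | 2 ^+ i * c i x < v.+1%:R] `\` [set x | 2 ^+ i * c i x < v%:R].
    exact: baire_propertyD.
  have ge0 x : 0 <= 2 ^+ i * c i x by rewrite mulr_ge0 ?(ltW (p0 i))//; case/andP: (c01 i x).
  apply/seteqP; split=> x /=; rewrite /T.
    move=> <-; have /andP[l u] := truncn_itv (ge0 x).
    by split=> //; apply/negP; rewrite -leNgt.
  by move=> [u /negP]; rewrite -leNgt => l; apply: truncn_def; rewrite l u.
pose tt i x := (T i x)%:R * 2 ^- i : R.
have tc i x : tt i x <= c i x < tt i x + 2 ^- i.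
  have ge0 : 0 <= 2 ^+ i * c i x by rewrite mulr_ge0 ?(ltW (p0 i))//; case/andP: (c01 i x).
  have /andP[l u] := truncn_itv ge0.
  rewrite ler_pdivrMr// mulrC l/= /tt -[X in _ + X]mul1r -mulrDl ltr_pdivlMr//.
  by rewrite mulrC natr1.
have tt01 x : unit_valued (tt ^~ x).
  move=> i; have := tc i x; have := c01 i x.
  have : 0 <= tt i x by rewrite mulr_ge0// invr_ge0 ltW.
  lra.
have c_tt x : series_close g (c ^~ x) (tt ^~ x).
  apply: (series_close_dyadic gg) => [i|//|i]; first exact: c01.
  by have := tc i x; rewrite ler_norml; lra.
have redP x y : series_close f (fun n => dyadic_value R (x n)) (fun n => dyadic_value R (y n))
    <-> series_close g (tt ^~ x) (tt ^~ y).
  have -> : series_close f (fun n => dyadic_value R (x n)) (fun n => dyadic_value R (y n))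
      <-> E_rel f (pt x) (pt y).
    rewrite (E_rel_close gf).
    suff e z : (fun n => cube_coord n (pt z)) = (fun n => dyadic_value R (z n)) by rewrite !e.
    by apply/funext => n; rewrite cube_pointK// dyadic_value01.
  rewrite red (E_rel_close gg).
  have c1 z : unit_valued (fun n => cube_coord n (theta (pt z))) by move=> i; exact: c01.
  split=> h.
    apply: (series_close_trans gg) (c_tt y) => //.
    by apply: (series_close_trans gg) h => //; exact: series_close_sym (c_tt x).
  apply: (series_close_trans gg) (series_close_sym (c_tt y)) => //.
  by apply: (series_close_trans gg) h => //; exact: c_tt.
(* The cap at [1] keeps the argument in the domain of [g] for arbitrary integers; on actual outputs
   it is inactive. *)
pose w i u v : R := g (Num.min 1 `|u%:R * 2 ^- i - v%:R * 2 ^- i|).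
have wE i x y : w i (T i x) (T i y) = g `|tt i x - tt i y|.
  by rewrite /w min_r//; case/andP: (dist01 i (tt01 x) (tt01 y)).
have wmin01 (r : R) : 0 <= Num.min 1 `|r| <= 1.
  by rewrite ge_min lexx andbT le_min ler01 normr_ge0.
have [||x y [n xy]||e [b [L [binj eb efix [L0 Lm] eL]]]] :=
  @fusion R T w (fun j => [seq dyadic_code (m j) i | i <- iota 0 (2 ^ m j).+1])
    (fun j => 2 ^- j) bT.
- by move=> i u v; apply: (gauge_ge0 gg).
- by move=> i v; rewrite /w subrr normr0 min_r// (gauge0 gg).
(* Eventually equal inputs are equivalent for [f], so the reduction makes their images equivalent
   for [g]. *)
- have : series_close g (tt ^~ x) (tt ^~ y).
    apply/redP; apply: (@bounded_series_finite _ _ n) => k.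
      by move=> nk; rewrite xy// subrr normr0 (gauge0 gf).
    by apply: (gauge_ge0 gf); apply: (@dist01 _ (fun n => dyadic_value R (x n)) (fun n => dyadic_value R (y n))) => i; exact: dyadic_value01.
  by move=> [M MP]; exists M => k; under eq_bigr do rewrite wE; exact: MP.
- by move=> j; case/andP: (dyadic01 R j).
pose code (p : nat -> nat) j := dyadic_code (m j) (p j).
(* Block [j] of the modular map is computed with all other inputs set to [0]. *)
pose upd (j p i : nat) := if i == j then p else 0%N.
exists L, (fun j p i => tt i (e (code (upd j p)))); split=> [j p i|p q pm qm]; first exact: tt01.
have codeF r : (forall j, (r j <= 2 ^ m j)%N) ->
    forall j, code r j \in [seq dyadic_code (m j) i | i <- iota 0 (2 ^ m j).+1].
  by move=> rm j; apply/mapP; exists (r j) => //; rewrite mem_iota add0n ltnS rm.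
have -> : bounded_series (fun j => f `|(p j)%:R * 2 ^- m j - (q j)%:R * 2 ^- m j|) <->
    series_close f (fun n => dyadic_value R (e (code p) n)) (fun n => dyadic_value R (e (code q) n)).
  rewrite /series_close [X in _ <-> X](bounded_series_inj binj).
  - suff -> : (fun j => f `|(p j)%:R * 2 ^- m j - (q j)%:R * 2 ^- m j|) =
        (fun n => f `|dyadic_value R (e (code p) n) - dyadic_value R (e (code q) n)|) \o b.
      by [].
    by apply/funext => j /=; rewrite !eb /code !dyadic_codeK.
  - by move=> n; apply: (gauge_ge0 gf); apply: (@dist01 _ (fun n => dyadic_value R (e (code p) n)) (fun n => dyadic_value R (e (code q) n))) => i; exact: dyadic_value01.
  - by move=> n /efix nb; rewrite (nb _ (code q)) subrr normr0 (gauge0 gf).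
rewrite redP.
pose blk j x y := \sum_(L j <= i < L j.+1) g `|tt i (e (code x)) - tt i (e (code y))|.
have blk_sym j x y : blk j x y = blk j y x.
  by apply: eq_bigr => i _; rewrite distrC.
have blk_tri j x y z : blk j x z <= D * (blk j x y + blk j y z).
  rewrite /blk -big_split mulr_sumr; apply: ler_sum => i _; apply: tri; try exact: dist01 i (tt01 _) (tt01 _).
  by apply: le_trans (ler_normD _ _); rewrite addrA subrK.
have upd_close j r : (forall j, (r j <= 2 ^ m j)%N) -> blk j r (upd j (r j)) <= 2 ^- j.
  (* [r'] interpolates: it agrees with [r] up to [j], which fixes the outputs below [L j.+1], and
     with [upd j (r j)] from [j] on, which moves the outputs from [L j] on by at most [2 ^- j] in
     total. *)
  move=> rm; pose r' i := if (i <= j)%N then r i else 0%N.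
  have r'm i : (r' i <= 2 ^ m i)%N by rewrite /r'; case: ifP.
  have um i : (upd j (r j) i <= 2 ^ m i)%N by rewrite /upd; case: eqP => // ->.
  have [_ h1] := eL _ _ j.+1 (codeF _ rm) (codeF _ r'm).
  have [h2 _] := eL _ _ j (codeF _ r'm) (codeF _ um).
  apply: le_trans (h2 _ (L j.+1)).
    rewrite le_eqVlt; apply/orP; left; apply/eqP; apply: eq_big_nat => i /andP[_ ilt].
    by rewrite wE /tt h1// => k kj; rewrite /code /r' -ltnS kj.
  move=> i ji; rewrite /code /r' /upd; case: (ltngtP i j) ji => // -> _.
  by [].
rewrite /series_close -[X in X <-> _](bounded_series_blocks L0 Lm); last first.
  by move=> n; apply: (gauge_ge0 gg); exact: dist01 n (tt01 _) (tt01 _).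
have D0 : 0 < D by apply: lt_le_trans D1.
(* Two uses of the quasi-triangle inequality: summable changes of both arguments preserve
   boundedness. *)
have cmp x y x' y' : (forall j, blk j (x j) (x' j) <= 2 ^- j) ->
    (forall j, blk j (y j) (y' j) <= 2 ^- j) ->
    bounded_series (fun j => blk j (x j) (y j)) -> bounded_series (fun j => blk j (x' j) (y' j)).
  move=> xx yy bxy.
  have := bounded_seriesD bxy (bounded_seriesD (bounded_series_dyadic R) (bounded_series_dyadic R)).
  apply: (@le_bounded_series _ _ _ (D * D)); last by rewrite mulr_ge0// ltW.
  move=> j; have := blk_tri j (x' j) (x j) (y' j); have := blk_tri j (x j) (y j) (y' j).
  have := xx j; have := yy j; rewrite (blk_sym j (x' j) (x j)).
  have /andP[d0 _] := dyadic01 R j.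
  move: (blk j (x j) (y j)) (blk j (x j) (y' j)) (blk j (x' j) (y' j)) (blk j (x j) (x' j)) (blk j (y j) (y' j)).
  set d := 2 ^- j => A1 A2 A3 A4 A5 h5 h4 h2 h3.
  apply: le_trans h3 _; rewrite -mulrA ler_pM2l//.
  apply: le_trans (lerD h4 (le_trans h2 (ler_wpM2l (ltW D0) (lerD (lexx A1) h5)))) _.
  have : d <= D * d by rewrite ler_peMl// ltW.
  lra.
split.
- by apply: (cmp (fun=> p) (fun=> q) (fun j => upd j (p j)) (fun j => upd j (q j))) => j;
  exact: upd_close.
- by apply: (cmp (fun j => upd j (p j)) (fun j => upd j (q j)) (fun=> p) (fun=> q)) => j;
  rewrite blk_sym; exact: upd_close.
Qed.

(** * Grid steps of a coordinatewise reduction *)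

Section ModularAnalysis.
Variables (R : realType) (Cf Cg : R) (f g : R -> R) (m L : nat -> nat).
Variable t : nat -> nat -> nat -> R.
Hypotheses (gf : gauge Cf f) (gg : gauge Cg g).
Hypothesis t01 : forall j p, unit_valued (t j p).
Hypothesis modular : forall p q : nat -> nat, (forall j, (p j <= 2 ^ m j)%N) ->
  (forall j, (q j <= 2 ^ m j)%N) ->
  bounded_series (fun j => f `|(p j)%:R * 2 ^- m j - (q j)%:R * 2 ^- m j|) <->
  bounded_series (fun j => \sum_(L j <= i < L j.+1) g `|t j (p j) i - t j (q j) i|).

Let d j p q := \sum_(L j <= i < L j.+1) g `|t j p i - t j q i|.

Let d_ge0 j p q : 0 <= d j p q.
Proof. by apply: sumr_ge0 => i _; apply: (gauge_ge0 gg); exact: dist01 i (t01 _ _) (t01 _ _). Qed.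

Let d_refl j p : d j p p = 0.
Proof. by rewrite /d big1// => i _; rewrite subrr normr0 (gauge0 gg). Qed.

(** If the images of the ends came arbitrarily close at arbitrarily large [j], jumping from [0] to
    [1] along a sparse set of coordinates would cost a bounded sum for [g] but infinitely many terms
    [f 1]. *)
Lemma modular_endpoints : exists2 c0, 0 < c0 &
  exists j0, forall j, (j0 <= j)%N -> c0 <= d j 0 (2 ^ m j).
Proof.
apply: contrapT => none.
have /choice[h hP] : forall a : nat * nat, exists j,
    (a.2 <= j)%N /\ d j 0 (2 ^ m j) <= 2 ^- a.1.
  move=> [n j0] /=; apply: contrapT => no; apply: none.
  exists (2 ^- n); first by case/andP: (dyadic01 R n).
  exists j0 => j jj0; rewrite leNgt; apply/negP => lt.
  by apply: no; exists j; rewrite jj0 ltW.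
pose s := fix s n := if n is n'.+1 then h (n, (s n').+1) else h (0%N, 0%N).
have s_homo : {homo s : i j / (i < j)%N}.
  by apply: homo_ltn => [|n]; [exact: ltn_trans|exact: (hP (n.+1, (s n).+1)).1].
have s_inj : injective s.
  move=> i j ij; have [lt|lt|//] := ltngtP i j.
    by have := s_homo _ _ lt; rewrite ij ltnn.
  by have := s_homo _ _ lt; rewrite ij ltnn.
have ds n : d (s n) 0 (2 ^ m (s n)) <= 2 ^- n by case: n => [|n]; exact: (hP (_, _)).2.
pose q j := if `[< exists n, s n = j >] then (2 ^ m j)%N else 0%N.
have qs n : q (s n) = (2 ^ m (s n))%N.
  by rewrite /q; case: asboolP => // no; exfalso; apply: no; exists n.
have qn j : (forall n, s n != j) -> q j = 0%N.
  by move=> sj; rewrite /q; case: asboolP => // -[n /eqP]; rewrite (negbTE (sj n)).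
have qm j : (q j <= 2 ^ m j)%N by rewrite /q; case: ifP.
have bd : bounded_series (fun j => d j 0 (q j)).
  rewrite (bounded_series_inj s_inj)//; last by move=> j /qn->; exact: d_refl.
  apply: (@le_bounded_series _ _ _ 1) (bounded_series_dyadic R) => // n /=.
  by rewrite mul1r qs ds.
have := (modular (fun j => leq0n _) qm).2 bd.
rewrite (bounded_series_inj s_inj); last 2 first.
- move=> j; apply: (gauge_ge0 gf); rewrite mul0r sub0r normrN.
  have /andP[d0 d1] := dyadic01 R (m j).
  rewrite ger0_norm ?mulr_ge0 ?(ltW d0)//= ler_pdivrMr ?exprn_gt0// mul1r.
  by rewrite -natrX ler_nat.
- by move=> j /qn->; rewrite subrr normr0 (gauge0 gf).
have f1 : 0 < f 1 by apply: (gauge_gt0 gf).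
move=> [M MP]; have := MP (Num.truncn (M / f 1)).+1.
rewrite (eq_bigr (fun=> f 1)); last first.
  move=> n _ /=; rewrite qs mul0r sub0r normrN natrX divff ?normr1// lt0r_neq0// exprn_gt0.
rewrite sumr_const_nat subn0 -[leLHS]mulr_natl -ler_pdivlMr// leNgt.
by rewrite real_truncnS_gt// num_real.
Qed.

(** Pigeonhole: [gauge_chain], applied to each output coordinate of the block, bounds from below the
    sum over all [2 ^ m j] steps, so some step reaches the average. *)
Lemma modular_step : exists2 D, 0 < D & forall j, exists2 s, (s < 2 ^ m j)%N &
  g (2 ^- m j) * d j 0 (2 ^ m j) <= D * d j s s.+1.
Proof.
have [D D0 chain] := gauge_chain gg; exists D => // j.
set N := (2 ^ m j)%N; have N0 : (0 < N)%N by rewrite expn_gt0.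
have NE : N%:R^-1 = 2 ^- m j :> R by rewrite natrX.
apply: contrapT => none.
have lt s : (s < N)%N -> D * d j s s.+1 < g (2 ^- m j) * d j 0 N.
  by move=> sN; rewrite ltNge; apply/negP => le; apply: none; exists s.
have le : N%:R * (g (2 ^- m j) * d j 0 N) <= D * \sum_(0 <= s < N) d j s s.+1.
  rewrite /d exchange_big_nat/= !mulr_sumr; apply: ler_sum => i _.
  rewrite (mulrC (g (2 ^- m j))) -NE; apply: chain => //.
  - by move=> s; exact: dist01 i (t01 _ _) (t01 _ _).
  - exact: dist01 i (t01 _ _) (t01 _ _).
  rewrite -normrN opprB.
  have -> : t j N i - t j 0 i = \sum_(0 <= s < N) (t j s.+1 i - t j s i).
    by rewrite telescope_sumr.
  apply: le_trans (ler_norm_sum _ _ _) _.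
  by apply: ler_sum => s _; rewrite distrC.
have : D * \sum_(0 <= s < N) d j s s.+1 < N%:R * (g (2 ^- m j) * d j 0 N).
  have -> : N%:R * (g (2 ^- m j) * d j 0 N) =
      \sum_(0 <= s < N) (g (2 ^- m j) * d j 0 N).
    by rewrite sumr_const_nat subn0 mulr_natl.
  rewrite mulr_sumr.
  apply: ltr_sum_nat => // s /andP[_ sN]; exact: lt.
by rewrite ltNge le.
Qed.

(** On each active coordinate [p] and [q] are the ends of the step given by [modular_step]. They are
    one mesh apart, so boundedness for [f] passes to the image blocks, and from [j0] on these
    dominate [c0 / D * g (2 ^- m j)]. *)
Lemma modular_obstruction (act : pred nat) :
  bounded_series (fun j => if act j then f (2 ^- m j) else 0) ->
  bounded_series (fun j => if act j then g (2 ^- m j) else 0).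
Proof.
move=> bf; have [c0 c00 [j0 c0P]] := modular_endpoints.
have [D D0 step] := modular_step.
have /choice[s sP] : forall j, exists s, (s < 2 ^ m j)%N /\
    g (2 ^- m j) * d j 0 (2 ^ m j) <= D * d j s s.+1.
  by move=> j; have [s] := step j; exists s.
pose p j := if act j then s j else 0%N; pose q j := if act j then (s j).+1 else 0%N.
have pm j : (p j <= 2 ^ m j)%N by rewrite /p; case: ifP => // _; rewrite ltnW ?(sP j).1.
have qm j : (q j <= 2 ^ m j)%N by rewrite /q; case: ifP => // _; rewrite (sP j).1.
have bd : bounded_series (fun j => d j (p j) (q j)).
  apply/(modular pm qm); move: bf; congr bounded_series; apply/funext => j.
  rewrite /p /q; case: ifP => _; last by rewrite subrr normr0 (gauge0 gf).
  rewrite -mulrBl -(natr1 (s j)) opprD addrA subrr sub0r mulN1r normrN.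
  by rewrite gtr0_norm//; case/andP: (dyadic01 R (m j)).
have g0 n : 0 <= g (2 ^- n) by apply: (gauge_ge0 gg); have /andP[? ?] := dyadic01 R n; lra.
(* The finitely many coordinates before the endpoint bound starts go into a separate series. *)
pose a j := if (j < j0)%N then g (2 ^- m j) else 0.
have ba : bounded_series a.
  apply: (@bounded_series_finite _ _ j0) => j; rewrite /a; first by move=> /leq_gtF->.
  by case: ifP.
have ba' : bounded_series (fun j => D / c0 * a j).
  by apply: le_bounded_series ba => //; rewrite divr_ge0// ltW.
apply: (@le_bounded_series _ _ (fun j => D / c0 * d j (p j) (q j) + a j) 1) => //; last first.
  apply: bounded_seriesD ba.
  by apply: le_bounded_series bd => //; rewrite divr_ge0// ltW.
move=> j; rewrite mul1r; have Dc : 0 <= D / c0 by rewrite divr_ge0// ltW.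
have a0 : 0 <= a j by rewrite /a; case: ifP.
case: ifP => [actj|_]; last by rewrite addr_ge0// mulr_ge0.
have [jj0|j0j] := ltnP j j0; first by rewrite /a jj0 lerDr mulr_ge0.
rewrite /a ltnNge j0j/= addr0 /p /q actj mulrAC ler_pdivlMr//.
apply: le_trans (sP j).2; rewrite ler_wpM2l//; exact: c0P.
Qed.

End ModularAnalysis.

Lemma bounded_indicator_series (R : realType) (e : nat -> nat * nat) (M : nat -> nat)
    (v : nat -> R) : set_bij setT setT e -> (forall i, 0 <= v i) ->
  bounded_series (fun j => if ((e j).2 < M (e j).1)%N then v (e j).1 else 0) <->
  bounded_series (fun i => (M i)%:R * v i).
Proof.
move=> be v0.
have sumE i m : \sum_(0 <= k < m) (if (k < M i)%N then v i else 0) = (minn m (M i))%:R * v i.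
  elim: m => [|m IH]; first by rewrite big_geq// min0n mul0r.
  rewrite big_nat_recr//= IH; have [lt|le] := ltnP m (M i).
    by rewrite (minn_idPl lt) -natr1 mulrDl mul1r.
  by rewrite (minn_idPr (leqW le)) addr0.
apply: (@bounded_pair_series R e (fun p => if (p.2 < M p.1)%N then v p.1 else 0) _ 1 1) => //.
- by move=> [i k] /=; case: ifP.
- by move=> i m /=; rewrite sumE mul1r ler_wpM2r// ler_nat geq_minr.
- by move=> i; exists (M i); rewrite /= sumE minnn mul1r.
Qed.

Lemma irreducible_of_small_ratio (R : realType) (Cf Cg : R) (f g : R -> R) :
  gauge Cf f -> gauge Cg g ->
  (forall eps, 0 < eps -> exists n, f (2 ^- n) <= eps * g (2 ^- n)) ->
  ~ Borel_reducible (E_rel f) (E_rel g).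
Proof.
move=> gf gg small red; have Cf1 := gauge_ge1 gf; have Cg1 := gauge_ge1 gg.
have /choice[N NP] : forall i, exists n, f (2 ^- n) <= 2 ^- i * g (2 ^- n).
  by move=> i; apply: small; case/andP: (dyadic01 R i).
have fpos n : 0 < f (2 ^- n) by have /andP[? ?] := dyadic01 R n; exact: (gauge_gt0 gf).
have gpos n : 0 < g (2 ^- n) by have /andP[? ?] := dyadic01 R n; exact: (gauge_gt0 gg).
(* With [M i] repetitions of mesh [2 ^- N i], the [f]-sum is at most [2 ^- i + f (2 ^- N i)], which
   is summable, while the [g]-sum is at least [1]. *)
pose M i := (Num.truncn (2 ^- i / f (2 ^- N i))).+1.
have [e be] := nat_pair_bij.
(* The mesh at [j] depends only on the first component of [e j], so each index [i] gets infinitely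
   many copies; [M i] of them are made active. *)
have [L [t [t01 modular]]] := @modular_reduction _ _ _ _ _ (fun j => N (e j).1) gf gg red.
have := @modular_obstruction _ _ _ _ _ _ _ _ gf gg t01 modular
  (fun j => ((e j).2 < M (e j).1)%N).
rewrite (@bounded_indicator_series _ e M (fun i => f (2 ^- N i)) be); last by move=> i; exact: ltW.
rewrite (@bounded_indicator_series _ e M (fun i => g (2 ^- N i)) be); last by move=> i; exact: ltW.
have q0 i : 0 < 2 ^- i / f (2 ^- N i).
  by rewrite divr_gt0//; case/andP: (dyadic01 R i).
have g1 : 0 < g 1 by apply: (gauge_gt0 gg).
case.
  apply: (@le_bounded_series _ _ _ (1 + Cg * g 1)) (bounded_series_dyadic R); last first.
    by rewrite addr_ge0// mulr_ge0// ltW//; lra.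
  move=> i; rewrite /M -(natr1 (Num.truncn _)) mulrDl mul1r mulrDl mul1r; apply: lerD.
    by rewrite -ler_pdivlMr// truncn_le ltW.
  have /andP[d0 d1] := dyadic01 R (N i); have /andP[i0 _] := dyadic01 R i.
  apply: le_trans (NP i) _; rewrite mulrC ler_pM2r//.
  by apply: (gauge_incr gg) => //; exact: ltW.
move=> B BP; have := BP (Num.truncn B).+1; rewrite leNgt => /negP; apply.
apply: lt_le_trans (real_truncnS_gt (num_real B)) _.
rewrite -[leLHS]mulr1n -[X in X%:R]subn0.
apply: le_trans (_ : \sum_(0 <= i < (Num.truncn B).+1) 1 <= _).
  by rewrite sumr_const_nat.
apply: ler_sum_nat => i _.
apply: (@le_trans _ _ (2 ^- i / f (2 ^- N i) * g (2 ^- N i))).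
  by rewrite mulrAC ler_pdivlMr// mul1r.
by rewrite ler_pM2r// ltW// real_truncnS_gt// num_real.
Qed.

(** * The functions f_U *)

Section Gauges.
Variable R : realType.

(** For [x <= y] one has [x ^+ 2 <= x * y], so the condition on squares already bounds [psi x] by a
    multiple of [psi (x * y)], and [psi y] is at most [C * psi 1]. *)
Lemma slow_submultiplicative (psi : R -> R) (C lambda : R) :
  (forall x, 0 <= x <= 1 -> 0 <= psi x) -> 1 <= C ->
  (forall x y, 0 <= x <= 1 -> 0 <= y <= 1 -> x <= y -> psi x <= C * psi y) ->
  0 < lambda -> (forall x, 0 <= x <= 1 -> lambda * psi x <= psi (x ^+ 2)) ->
  forall x y, 0 <= x <= 1 -> 0 <= y <= 1 ->
    psi x * psi y <= C / lambda * (C * psi 1) * psi (x * y).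
Proof.
move=> psi0 C1 incr l0 sq x y; wlog xy : x y / x <= y.
  move=> W x01 y01; have [le|/ltW le] := leP x y; first exact: W.
  by rewrite mulrC (mulrC x); exact: W.
move=> x01 y01; have xy01 : 0 <= x * y <= 1.
  by case/andP: x01 => ? ?; case/andP: y01 => ? ?; rewrite mulr_ge0//= mulr_ile1.
have xx01 : 0 <= x ^+ 2 <= 1 by case/andP: x01 => ? ?; rewrite sqr_ge0 expr_le1.
have h1 : psi x <= C / lambda * psi (x * y).
  rewrite mulrAC ler_pdivlMr// mulrC; apply: le_trans (sq _ x01) _.
  by apply: incr => //; rewrite expr2 ler_wpM2l//; case/andP: x01.
have h2 : psi y <= C * psi 1.
  by apply: incr => //; [rewrite ler01 lexx|case/andP: y01].
rewrite mulrAC; apply: ler_pM => //; exact: psi0.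
Qed.

Lemma powR_slope (alpha x y : R) : 1 <= alpha -> 0 <= x -> x <= y ->
  y * x `^ alpha <= x * y `^ alpha.
Proof.
move=> a1 x0 xy; have [x_0|xn0] := eqVneq x 0.
  by rewrite x_0 powR0 ?mulr0 ?mul0r//; apply/negP => /eqP; lra.
have xp : 0 < x by rewrite lt0r xn0.
have y0 : 0 <= y by exact: le_trans xy.
rewrite -(mulr_powRB1 x0) -1?(mulr_powRB1 y0); [|lra|lra].
rewrite mulrCA ler_pM2l// ler_pM2l; last exact: lt_le_trans xy.
by apply: ge0_ler_powR; rewrite ?nnegrE//; lra.
Qed.

(** The power supplies the slope, as [1 <= alpha], and is exactly multiplicative; the two slow
    factors contribute only constants. *)
Lemma f_gauge (alpha C1 C2 l1 l2 : R) (phi psi : R -> R) : 1 <= alpha ->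
  (forall x, 0 <= x <= 1 -> 0 <= phi x) ->
  (forall x, 0 <= x <= 1 -> 0 < x -> 0 < phi x) -> 1 <= C1 ->
  (forall x y, 0 <= x <= 1 -> 0 <= y <= 1 -> x <= y -> phi x <= C1 * phi y) ->
  0 < l1 -> (forall x, 0 <= x <= 1 -> l1 * phi x <= phi (x ^+ 2)) ->
  (forall x, 0 <= x <= 1 -> 0 <= psi x) ->
  (forall x, 0 <= x <= 1 -> 0 < x -> 0 < psi x) -> 1 <= C2 ->
  (forall x y, 0 <= x <= 1 -> 0 <= y <= 1 -> x <= y -> psi x <= C2 * psi y) ->
  0 < l2 -> (forall x, 0 <= x <= 1 -> l2 * psi x <= psi (x ^+ 2)) ->
  exists C, gauge C (f_ alpha phi psi).
Proof.
move=> a1 phi0 phip C11 phii l10 phiq psi0 psip C21 psii l20 psiq.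
pose A := C1 / l1 * (C1 * phi 1) * (C2 / l2 * (C2 * psi 1)).
pose C := Num.max (C1 * C2) A.
have CC1 : 1 <= C1 * C2 by rewrite mulr_ege1.
have pw0 x : 0 <= x `^ alpha by exact: powR_ge0.
have f0 x : 0 <= x <= 1 -> 0 <= f_ alpha phi psi x.
  by move=> x01; rewrite /f_ !mulr_ge0 ?phi0 ?psi0.
exists C; split.
- by rewrite /f_ powR0 ?mul0r//; apply/negP => /eqP; lra.
- move=> x x0 x1; have x01 : 0 <= x <= 1 by lra.
  by rewrite /f_ !mulr_gt0 ?powR_gt0 ?phip ?psip.
- by rewrite /C le_max CC1.
- move=> x y x0 xy y1; have x01 : 0 <= x <= 1 by lra.
  have y01 : 0 <= y <= 1 by lra.
  apply: (@le_trans _ _ (C1 * C2 * (x * f_ alpha phi psi y))); last first.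
    apply: ler_wpM2r; first by rewrite mulr_ge0 ?f0.
    by rewrite /C le_max lexx.
  rewrite /f_ !mulrA -!(mulrA _ (phi _)).
  have -> : C1 * C2 * x * y `^ alpha * (phi y * psi y) =
    x * y `^ alpha * ((C1 * phi y) * (C2 * psi y)) by ring.
  apply: ler_pM; rewrite ?mulr_ge0 ?phi0 ?psi0//; first lra.
    exact: powR_slope.
  by apply: ler_pM; rewrite ?phi0 ?psi0// ?phii ?psii.
- move=> x y x01 y01; have xy01 : 0 <= x * y <= 1.
    by case/andP: x01 => ? ?; case/andP: y01 => ? ?; rewrite mulr_ge0//= mulr_ile1.
  apply: (@le_trans _ _ (A * f_ alpha phi psi (x * y))); last first.
    apply: ler_wpM2r; first exact: f0.
    by rewrite /C le_max lexx orbT.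
  have h1 := slow_submultiplicative phi0 C11 phii l10 phiq x01 y01.
  have h2 := slow_submultiplicative psi0 C21 psii l20 psiq x01 y01.
  rewrite /f_ powRM; [|by case/andP: x01|by case/andP: y01].
  have -> : x `^ alpha * phi x * psi x * (y `^ alpha * phi y * psi y) =
    x `^ alpha * y `^ alpha * ((phi x * phi y) * (psi x * psi y)) by ring.
  have -> : A * (x `^ alpha * y `^ alpha * phi (x * y) * psi (x * y)) =
    x `^ alpha * y `^ alpha * ((C1 / l1 * (C1 * phi 1) * phi (x * y)) *
      (C2 / l2 * (C2 * psi 1) * psi (x * y))) by rewrite /A; ring.
  rewrite ler_wpM2l ?mulr_ge0//; apply: ler_pM => //.
    by rewrite mulr_ge0 ?phi0.
  by rewrite mulr_ge0 ?psi0.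
Qed.

End Gauges.

(** * The blocks I_l and the sequences u_U *)

Lemma a_ltS l : (a_ l < a_ l.+1)%N.
Proof. by rewrite /= addn1 ltnS leq_addr. Qed.

Lemma a_homo : {homo a_ : i j / (i <= j)%N}.
Proof.
by apply: homo_leq => [//|n m p|n]; [exact: leq_trans|exact: ltnW (a_ltS n)].
Qed.

Lemma a_gt0 l : (0 < l)%N -> (0 < a_ l)%N.
Proof. by case: l => // l _; exact: leq_ltn_trans (a_ltS l). Qed.

Lemma I_P l m : I_ l m <-> (a_ l <= m < a_ l.+1)%N.
Proof. by []. Qed.

Lemma I_inj l l' m : I_ l m -> I_ l' m -> l = l'.
Proof.
move=> /I_P/andP[l1 l2] /I_P/andP[l1' l2'].
have [lt|lt|//] := ltngtP l l'.
  by have := leq_trans l2 (leq_trans (a_homo lt) l1'); rewrite ltnn.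
by have := leq_trans l2' (leq_trans (a_homo lt) l1); rewrite ltnn.
Qed.

Section USequence.
Variables (R : realType) (delta : nat -> R) (k : nat -> nat) (d0 d1 : R).
Hypotheses (d0_gt0 : 0 < d0) (d1_lt1 : d1 < 1).
Hypothesis delta_itv : forall m, d0 <= delta m <= d1.
Hypotheses (k_ge2 : forall m, (2 <= k m)%N).
Hypothesis k_double : forall m, (2 * k m <= k m.+1)%N.
Implicit Types (U V : set nat) (m n : nat).

Let sel U m : Prop := exists2 l, U l & I_ l m.
Let factor U m : R := if `[< sel U m >] then delta m else 1.

Let k_lt : {homo k : m n / (m < n)%N}.
Proof.
apply: homo_ltn => [|n]; first exact: ltn_trans.
by have := k_double n; have := k_ge2 n; lia.
Qed.

Let k_le m n : (k m <= k n)%N = (m <= n)%N.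
Proof.
have [le|lt] := leqP m n; last by rewrite leqNgt k_lt.
by move: le; rewrite leq_eqVlt => /orP[/eqP->|/k_lt/ltnW//]; exact: leqnn.
Qed.

Let k_inj : injective k.
Proof. by move=> m n e; apply/eqP; rewrite eqn_leq -(k_le m n) -(k_le n m) e leqnn. Qed.

Let factor_itv U m : d0 <= factor U m <= 1.
Proof. by rewrite /factor; have := delta_itv m; have := d1_lt1; case: ifP => _; lra. Qed.

Lemma u_hit U n m : n.+1 = k m -> u_ delta k U n.+1 = factor U m * u_ delta k U n.
Proof.
move=> nm; rewrite /=; case: pselect => [h|h].
  case: (cid h) => m' /= [nm' sm'].
  have -> : m' = m by apply: k_inj; rewrite -nm' nm.
  by move: sm'; rewrite (k_inj (etrans (esym nm') nm)) /factor => /asboolP ->.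
by rewrite /factor; case: asboolP => [sm|_]; rewrite ?mul1r//; case: h; exists m.
Qed.

Lemma u_miss U n : (forall m, n.+1 <> k m) -> u_ delta k U n.+1 = u_ delta k U n.
Proof. by move=> nk /=; case: pselect => // h; have [m [/nk]] := h. Qed.

Lemma u_gt0 U n : 0 < u_ delta k U n.
Proof.
elim: n => [|n IH]; first exact: ltr01.
have [[m nm]|none] := pselect (exists m, n.+1 = k m); last first.
  by rewrite u_miss// => m nm; apply: none; exists m.
by rewrite (u_hit _ nm) mulr_gt0//; have := factor_itv U m; have := d0_gt0; lra.
Qed.

Lemma u_step U n : d0 * u_ delta k U n <= u_ delta k U n.+1 <= u_ delta k U n.
Proof.
have u0 := u_gt0 U n; have d01 : d0 <= 1 by have := delta_itv 0; have := d0_gt0; have := d1_lt1; lra.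
have [[m nm]|none] := pselect (exists m, n.+1 = k m); last first.
  rewrite u_miss; last by move=> m nm; apply: none; exists m.
  by rewrite lexx andbT ler_piMl// ltW.
have /andP[f0 f1] := factor_itv U m.
by rewrite (u_hit _ nm); apply/andP; split; [rewrite ler_wpM2r// ltW|rewrite ler_piMl// ltW].
Qed.

Lemma u_noninc U m n : (m <= n)%N -> u_ delta k U n <= u_ delta k U m.
Proof.
elim: n => [|n IH]; first by rewrite leqn0 => /eqP->.
rewrite leq_eqVlt => /orP[/eqP->//|/IH]; apply: le_trans.
by case/andP: (u_step U n).
Qed.

Lemma u_const U p q : (p <= q)%N -> (forall m, ~ (p < k m <= q)%N) ->
  u_ delta k U q = u_ delta k U p.
Proof.
elim: q => [|q IH]; first by rewrite leqn0 => /eqP->.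
rewrite leq_eqVlt => /orP[/eqP->//|pq] none.
rewrite u_miss; last by move=> m qm; apply: (none m); rewrite -qm pq leqnn.
by apply: IH => // m /andP[pm mq]; apply: (none m); rewrite pm leqW.
Qed.

(** At most two of the [k m] lie above [n] and up to [2 * n + 2]: if [k a] is the first one beyond
    [n], then [k a.+2 >= 4 * k a > 2 * n + 2]. *)
Lemma u_double U n : d0 ^+ 2 * u_ delta k U n <= u_ delta k U (2 * n + 2).
Proof.
have d01 : d0 <= 1 by have := delta_itv 0; have := d0_gt0; have := d1_lt1; lra.
have kgt m : (m < k m)%N.
  by elim: m => [|m IH]; [exact: leq_trans (k_ge2 0)|exact: leq_ltn_trans IH (k_lt (ltnSn m))].
have ex : exists a, (n < k a)%N by exists n.
case: (ex_minnP ex) => a na amin.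
(* Before [k (a + j)] at most [j] factors have been picked up since [n]. *)
have low j q : (n <= q < k (a + j))%N -> d0 ^+ j * u_ delta k U n <= u_ delta k U q.
  elim: j q => [|j IH] q /andP[nq qk].
    rewrite expr0 mul1r (u_const _ nq)// => m /andP[nm mq].
    have := leq_trans (leq_ltn_trans mq qk) _ (p := k m).
    by rewrite addn0 k_le ltnn => /(_ (amin _ nm)).
  have [lt|le] := ltnP q (k (a + j)).
    apply: le_trans (IH q _); last by rewrite nq.
    by rewrite exprS -mulrA ler_piMl// mulr_ge0 ?exprn_ge0// ltW// u_gt0.
  have -> : u_ delta k U q = u_ delta k U (k (a + j)).
    apply: u_const => // m /andP[lt1 lt2].
    have : (k m < k (a + j.+1))%N by exact: leq_ltn_trans qk.
    rewrite ltnNge k_le -ltnNge addnS ltnS => le'.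
    by move: lt1; rewrite ltnNge k_le le'.
  have nk : (n < k (a + j))%N by apply: leq_trans na _; rewrite k_le leq_addr.
  case E : (k (a + j)) nk => [//|b] nb.
  have /andP[st _] := u_step U b; apply: le_trans st.
  by rewrite exprS -mulrA ler_pM2l//; apply: IH; rewrite E ltnSn andbT -ltnS.
apply: low; apply/andP; split; first by lia.
rewrite (addn2 a); have := k_double a; have := k_double a.+1; lia.
Qed.

Lemma u_kS U m : u_ delta k U (k m.+1) = factor U m.+1 * u_ delta k U (k m).
Proof.
have lt := k_lt (ltnSn m); case E : (k m.+1) lt => [//|b] lt.
rewrite (u_hit _ (esym E)); congr (_ * _); apply: u_const => // m' /andP[lt1 lt2].
have : (k m' < k m.+1)%N by rewrite E.
by rewrite ltnNge k_le -ltnNge ltnS -k_le leqNgt lt1.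
Qed.

Lemma u_k_lower U m : d0 ^+ m.+1 <= u_ delta k U (k m).
Proof.
elim: m => [|m IH].
  rewrite expr1; case E : (k 0) => [|b]; first by have := k_ge2 0; rewrite E.
  rewrite (u_hit _ (esym E)); have -> : u_ delta k U b = u_ delta k U 0.
    apply: u_const => // m /andP[_ mb]; have : (k m < k 0)%N by rewrite E.
    by rewrite ltnNge k_le.
  by rewrite mulr1; case/andP: (factor_itv U 0).
rewrite u_kS exprS; apply: ler_pM => //; first exact: ltW.
  by rewrite exprn_ge0// ltW.
by case/andP: (factor_itv U m.+1).
Qed.

(** The block [I_ l] has [1 + l * a_ l] elements. Along it [u_U] picks up that many factors, each at
    most [d1], while [u_V] stays constant; before it [u_V] has picked up at most [a_ l] factors,
    each at least [d0]. *)
Lemma u_block_ratio U V l : U l -> ~ V l -> (0 < l)%N ->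
  exists n, u_ delta k U n * d0 ^+ a_ l <= (d1 ^+ l) ^+ a_ l * u_ delta k V n.
Proof.
move=> Ul nVl l0; have al := a_gt0 l0.
have d10 : 0 <= d1 by have := delta_itv 0; have := d0_gt0; have := d1_lt1; lra.
(* [b] is the last index before the block. *)
case E : (a_ l) (al) => [//|b] _.
have inI j : (j < 1 + l * a_ l)%N -> I_ l (b + j).+1.
  by move=> jl; rewrite /I_ /= E; lia.
have upper j : (j <= 1 + l * a_ l)%N -> u_ delta k U (k (b + j)) <= d1 ^+ j.
  elim: j => [_|j IH jl]; first by rewrite expr0 (u_noninc U (leq0n _)).
  rewrite addnS u_kS exprS; apply: ler_pM; last exact/IH/ltnW.
  - by rewrite (le_trans (ltW d0_gt0))//; case/andP: (factor_itv U (b + j).+1).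
  - exact/ltW/u_gt0.
  rewrite /factor; case: asboolP => [_|[]]; first by case/andP: (delta_itv (b + j).+1).
  by exists l => //; exact: inI.
have lower j : (j <= 1 + l * a_ l)%N -> u_ delta k V (k (b + j)) = u_ delta k V (k b).
  elim: j => [_|j IH jl]; first by rewrite addn0.
  rewrite addnS u_kS IH ?(ltnW jl)// /factor; case: asboolP => [[l' Vl' Il']|_].
    by have := I_inj Il' (inI _ jl) => e; rewrite e in Vl'.
  by rewrite mul1r.
exists (k (b + (1 + l * a_ l))); rewrite lower// -E.
apply: ler_pM; [exact/ltW/u_gt0|by rewrite exprn_ge0// ltW| |].
  apply: le_trans (upper _ (leqnn _)) _; rewrite -exprM exprD expr1.
  by rewrite ler_piMl ?exprn_ge0// ltW.
by rewrite E; exact: u_k_lower.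
Qed.

Lemma u_ratio_small U V : ~ almost_subset U V -> forall eps, 0 < eps ->
  exists n, u_ delta k U n <= eps * u_ delta k V n.
Proof.
(* The cap at [1] gives [e ^+ a_ l <= e] at the end; [l] is taken so large that [d1 ^+ l <= e * d0],
   after which [d0 ^+ a_ l] cancels. *)
move=> inf eps eps0; pose e := Num.min eps 1.
have e0 : 0 < e by rewrite lt_min eps0 ltr01.
have d10 : 0 < d1 by have := delta_itv 0; have := d0_gt0; have := d1_lt1; lra.
have [l0 l0P] : exists l0, d1 ^+ l0 < e * d0.
  have c : (fun n => d1 ^+ n) @ \oo --> (0 : R) by apply: cvg_expr; rewrite gtr0_norm.
  have ed : 0 < e * d0 by rewrite mulr_gt0.
  move/cvgrPdist_lt : c => /(_ _ ed)[N _ NP]; exists N.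
  by have := NP N (leqnn N); rewrite /= sub0r normrN ger0_norm// exprn_ge0// ltW.
have [l [Ul nVl l0l]] : exists l, [/\ U l, ~ V l & (l0 < l)%N].
  apply: contrapT => none; apply: inf.
  apply: (@sub_finite_set _ _ `I_l0.+1); last exact: finite_II.
  move=> l [Ul nVl] /=; rewrite ltnNge; apply/negP => lt.
  by apply: none; exists l.
have lpos : (0 < l)%N by exact: leq_ltn_trans l0l.
have [n nP] := u_block_ratio Ul nVl lpos; exists n.
have al := a_gt0 lpos.
have p0 : 0 < d0 ^+ a_ l by rewrite exprn_gt0.
rewrite -(ler_pM2r p0); apply: le_trans nP _.
rewrite mulrAC ler_wpM2r ?(ltW (u_gt0 _ _))//.
have d1l : d1 ^+ l <= e * d0.
  apply: le_trans (ltW l0P); apply: ler_wiXn2l; [exact: ltW|exact: ltW|exact: ltnW].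
apply: (@le_trans _ _ ((e * d0) ^+ a_ l)).
  by apply: lerXn2r => //; rewrite nnegrE ?exprn_ge0 ?mulr_ge0// ltW.
rewrite exprMn ler_pM2r//; apply: (@le_trans _ _ e); last by rewrite ge_min lexx.
case: (a_ l) al => // b _; rewrite exprS ler_piMr ?(ltW e0)//.
by rewrite exprn_ile1 ?(ltW e0)// ge_min lexx orbT.
Qed.

(** Past [k (a_ l0)] every index selected by [U] is selected by [V], so each step multiplies the
    numerator by at least as much as the denominator. *)
Lemma u_ratio_increasing U V : almost_subset U V -> exists n0, forall n, (n0 <= n)%N ->
  u_ delta k U n / u_ delta k V n <= u_ delta k U n.+1 / u_ delta k V n.+1.
Proof.
move=> fin; have [l0 l0P] : exists l0, forall l, U l -> ~ V l -> (l < l0)%N.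
  have [s sE] := (finite_seqP _).1 fin.
  exists (\max_(i <- s) i).+1 => l Ul nVl; rewrite ltnS.
  have ls : l \in s by have : [set` s] l by rewrite -sE.
  by rewrite (big_rem l)//= leq_maxl.
exists (k (a_ l0)) => n nk.
have uU := u_gt0 U n; have uV := u_gt0 V n; have uU' := u_gt0 U n.+1; have uV' := u_gt0 V n.+1.
rewrite ler_pdivrMr// mulrAC ler_pdivlMr//.
have [[m nm]|none] := pselect (exists m, n.+1 = k m); last first.
  by rewrite !u_miss// => m nm; apply: none; exists m.
have am : (a_ l0 <= m)%N by rewrite -k_le -nm leqW.
rewrite !(u_hit _ nm) mulrCA -[leRHS]mulrA ler_wpM2r ?mulr_ge0 ?(ltW uU) ?(ltW uV)//.
have [[l Ul Il]|nU] := pselect (sel U m); last first.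
  by rewrite [leRHS]/factor; case: asboolP => // _; case/andP: (factor_itv V m).
have Vl : V l.
  apply: contrapT => /(l0P _ Ul) lt; have /andP[_ ml] := Il.
  by have := leq_trans ml (leq_trans (a_homo lt) am); rewrite ltnn.
by rewrite /factor; case: asboolP => [_|[]]; [case: asboolP => // -[]; exists l|exists l].
Qed.

End USequence.

Theorem theorem4p2 (R : realType) (alpha : R) (halpha : 1 <= alpha)
  (delta : nat -> R) (hdelta : forall m, 0 < delta m < 1)
  (hdelta_inf : 0 < inf (range delta) <= sup (range delta))
  (hdelta_sup : sup (range delta) < 1)
  (k : nat -> nat) (hk_incr : {homo k : m n / (m <= n)%N})
  (hk_ge2 : forall m, (2 <= k m)%N)
  (hk_double : forall m, (2 * k m <= k m.+1)%N)
  (phi : R -> R)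
  (hphi_ge0 : forall x, `[0, 1]%classic x -> 0 <= phi x)
  (hphi_cont : {within `[0, 1], continuous phi})
  (hphi_incr : essentially_increasing `[0, 1] phi)
  (hphi_gt0 : forall x, `[0, 1]%classic x -> 0 < x -> 0 < phi x)
  (hphi_sq : exists2 lambda : R, 0 < lambda &
     forall x, `[0, 1]%classic x -> lambda * phi x <= phi (x ^+ 2))
  (phi_ : set nat -> R -> R)
  (hphiU_ge0 : forall U x, `[0, 1]%classic x -> 0 <= phi_ U x)
  (hphiU_cont : forall U, {within `[0, 1], continuous (phi_ U)})
  (hphiU_incr : forall U x y, `[0, 1]%classic x -> `[0, 1]%classic y ->
     x <= y -> phi_ U x <= phi_ U y)
  (hphiU_val : forall U n, phi_ U (1 / 2 ^+ n) = u_ delta k U n) :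
  (forall U : set nat,
     equivalence (unit_cube R) (E_rel (f_ alpha phi (phi_ U)))) /\
  (forall U V : set nat,
     almost_subset U V <->
     Borel_reducible (E_rel (f_ alpha phi (phi_ U)))
                     (E_rel (f_ alpha phi (phi_ V)))).
Proof.
have [C1 C11 phii] := hphi_incr; have [l1 l10 phiq] := hphi_sq.
set d0 := inf (range delta); set d1 := sup (range delta).
have bd m : d0 <= delta m <= d1.
  apply/andP; split.
    by apply: ge_inf; [exists 0 => _ [j _ <-]; case/andP: (hdelta j) => /ltW|exists m].
  by apply: ub_le_sup; [exists 1 => _ [j _ <-]; case/andP: (hdelta j) => _ /ltW|exists m].
have d00 : 0 < d0 by case/andP: hdelta_inf.
have u_pos := u_gt0 d00 hdelta_sup bd hk_ge2 hk_double.
(* For [2 ^- n.+1 < x <= 2 ^- n], monotonicity compares [phi_ U x] with [u_U] at [n] and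
   [phi_ U (x ^+ 2)] with [u_U] at [2 * n + 2], and [u_double] relates the two. *)
have slow U x : 0 <= x <= 1 -> d0 ^+ 2 * phi_ U x <= phi_ U (x ^+ 2).
  move=> x01; have x2 : 0 <= x ^+ 2 <= 1.
    by case/andP: x01 => ? ?; rewrite sqr_ge0 expr_le1.
  have d01 : d0 <= 1 by have := bd 0; have := hdelta_sup; rewrite -/d1; lra.
  have [x0|xn0] := ltP 0 x; last first.
    have -> : x = 0 by lra.
    rewrite expr0n/= ler_piMl//; first exact/hphiU_ge0/itv01P/andP.
    by rewrite exprn_ile1// ltW.
  have [n /andP[nx xn]] := dyadic_scale x0 (andP x01).2.
  have val m : phi_ U (2 ^- m) = u_ delta k U m by rewrite -hphiU_val div1r.
  have dy m : `[0 : R, 1]%classic (2 ^- m).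
    by apply/itv01P; have /andP[/ltW -> ->] := dyadic01 R m.
  apply: (@le_trans _ _ (d0 ^+ 2 * u_ delta k U n)).
    by rewrite ler_wpM2l ?exprn_ge0 ?(ltW d00)// -val; apply: hphiU_incr => //; exact/itv01P.
  apply: le_trans (u_double d00 hdelta_sup bd hk_ge2 hk_double U n) _.
  rewrite -val; apply: hphiU_incr; [exact: dy|exact/itv01P|].
  have -> : 2 ^- (2 * n + 2) = (2 ^- n.+1) ^+ 2 :> R.
    by rewrite exprVn -exprM (mulnC n.+1) mulnS (addnC 2).
  have /andP[/ltW n0 _] := dyadic01 R n.+1.
  by rewrite !expr2; apply: ler_pM => //; exact: ltW.
have gaugeU U : exists C, gauge C (f_ alpha phi (phi_ U)).
  apply: (@f_gauge _ alpha C1 1 l1 (d0 ^+ 2) _ _ halpha _ _ C11 _ l10).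
  - by move=> x /itv01P; exact: hphi_ge0.
  - by move=> x /itv01P; exact: hphi_gt0.
  - by move=> x y /itv01P x01 /itv01P y01; exact: phii.
  - by move=> x /itv01P; exact: phiq.
  - by move=> x /itv01P; exact: hphiU_ge0.
  - move=> x x01 x0; have [n nx] := dyadic_archi x0.
    apply: (@lt_le_trans _ _ (u_ delta k U n)); first exact: u_pos.
    rewrite -hphiU_val div1r; apply: hphiU_incr; [|exact/itv01P|exact: ltW].
    by apply/itv01P; have /andP[/ltW -> ->] := dyadic01 R n.
  - exact: lexx.
  - by move=> x y /itv01P x01 /itv01P y01 xy; rewrite mul1r; exact: hphiU_incr.
  - exact: exprn_gt0.
  - exact: slow.
have fval U n : f_ alpha phi (phi_ U) (2 ^- n) =
    (2 ^- n) `^ alpha * phi (2 ^- n) * u_ delta k U n.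
  by rewrite /f_ -hphiU_val div1r.
(* This factor is shared by [f_U] and [f_V], so on the grid it cancels and leaves the ratio of [u_U]
   to [u_V]. *)
have common n : 0 < (2 ^- n) `^ alpha * phi (2 ^- n).
  have /andP[n0 n1] := dyadic01 R n.
  by rewrite mulr_gt0 ?powR_gt0 ?hphi_gt0//; apply/itv01P; rewrite ltW.
split=> [U|U V].
  by have [C gC] := gaugeU U; exact: E_rel_equivalence gC.
have [CU gU] := gaugeU U; have [CV gV] := gaugeU V; split=> [UV|red].
  have [n0 n0P] := u_ratio_increasing d00 hdelta_sup bd hk_ge2 hk_double UV.
  apply: (reducible_of_increasing_ratio (n0 := n0) gU gV) => n nn0.
  have ratio i : f_ alpha phi (phi_ U) (2 ^- i) / f_ alpha phi (phi_ V) (2 ^- i) =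
      u_ delta k U i / u_ delta k V i.
    by rewrite !fval -mulf_div divff ?mul1r// lt0r_neq0.
  by rewrite !ratio; exact: n0P.
apply: contrapT => nUV; apply: (irreducible_of_small_ratio gU gV) red => eps eps0.
have [n nP] := u_ratio_small d00 hdelta_sup bd hk_ge2 hk_double nUV eps0.
by exists n; rewrite !fval mulrCA ler_pM2l.
Qed.
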